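(* Assume $\kappa=\kappa^{<\kappa}$. For every point $x$ of $S_\kappa$, the Stone–Čech compactification $\beta(S_\kappa\setminus\{x\})$ is a $\kappa$-Parovičenko space of weight $2^\kappa$.
   Context: A space is zero-dimensional if it has a base of clopen sets. For a zero-dimensional space $X$ and an open $U\subseteq X$, the ($X$-)type $\tau(U)$ is the least cardinal $\tau$ such that $U$ is a union of $\tau$ many clopen subsets of $X$. A zero-dimensional space is an $F_\kappa$-space if every open subset of type less than $\kappa$ is $C^*$-embedded (every bounded continuous real-valued function on it extends continuously to the whole space). A space is a $G_\kappa$-space if every non-empty intersection of fewer than $\kappa$ open sets has non-empty interior. A $\kappa$-Parovičenko space is a compact Hausdorff zero-dimensional $F_\kappa$- and $G_\kappa$-space without isolated points (no weight restriction is imposed). If $\kappa=\kappa^{<\kappa}$ there is, up to homeomorphism, a unique $\kappa$-Parovičenko space of weight $\kappa$; it is denoted $S_\kappa$. *)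

(* Defs.v *)
From Stdlib Require Import Reals List.
Open Scope R_scope.

Record TopSpace := mkTop {
  carrier :> Type;
  is_open : (carrier -> Prop) -> Prop;
  open_full : is_open (fun _ => True);
  open_inter : forall U V, is_open U -> is_open V -> is_open (fun x => U x /\ V x);
  open_union : forall F : (carrier -> Prop) -> Prop,
      (forall U, F U -> is_open U) -> is_open (fun x => exists U, F U /\ U x)
}.
Arguments is_open {t} _.

Definition sub_open (X : TopSpace) (P : X -> Prop) (W : {x : X | P x} -> Prop) : Prop :=
  exists U : X -> Prop, is_open U /\ forall y, W y <-> U (proj1_sig y).

Lemma sub_open_full (X : TopSpace) (P : X -> Prop) : sub_open X P (fun _ => True).
Proof. exists (fun _ => True); split; [apply open_full | tauto]. Qed.

Lemma sub_open_inter (X : TopSpace) (P : X -> Prop) U V :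
  sub_open X P U -> sub_open X P V -> sub_open X P (fun x => U x /\ V x).
Proof.
  intros [U' [HU HU']] [V' [HV HV']].
  exists (fun x => U' x /\ V' x); split; [apply open_inter; assumption|].
  intros y; rewrite HU', HV'; tauto.
Qed.

Lemma sub_open_union (X : TopSpace) (P : X -> Prop) (F : ({x : X | P x} -> Prop) -> Prop) :
  (forall U, F U -> sub_open X P U) -> sub_open X P (fun x => exists U, F U /\ U x).
Proof.
  intros HF.
  exists (fun z => exists U', (is_open U' /\ exists W, F W /\ forall y, W y <-> U' (proj1_sig y)) /\ U' z).
  split.
  - apply open_union. intros U' [H _]; exact H.
  - intros y; split.
    + intros [W [FW Wy]]. destruct (HF W FW) as [U' [HU' HW]].
      exists U'. split; [split; [exact HU'| exists W; split; assumption]|].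
      apply HW; exact Wy.
    + intros [U' [[_ [W [FW HW]]] HU'y]]. exists W; split; [exact FW|].
      apply HW; exact HU'y.
Qed.

Definition subspace (X : TopSpace) (P : X -> Prop) : TopSpace :=
  mkTop {x : X | P x} (sub_open X P) (sub_open_full X P)
        (sub_open_inter X P) (sub_open_union X P).

Definition continuous (X Y : TopSpace) (f : X -> Y) : Prop :=
  forall V : Y -> Prop, is_open V -> is_open (fun x => V (f x)).

Definition R_open (U : R -> Prop) : Prop :=
  forall x, U x -> exists e, e > 0 /\ forall y, Rabs (y - x) < e -> U y.

Definition continuous_R (X : TopSpace) (f : X -> R) : Prop :=
  forall U, R_open U -> is_open (fun x => U (f x)).

Definition bounded_R (X : Type) (f : X -> R) : Prop :=
  exists M, forall x, Rabs (f x) <= M.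

Definition clopen (X : TopSpace) (U : X -> Prop) : Prop :=
  is_open U /\ is_open (fun x => ~ U x).

Definition is_base (X : TopSpace) (B : (X -> Prop) -> Prop) : Prop :=
  (forall U, B U -> is_open U) /\
  forall U, is_open U -> forall x, U x ->
    exists V, B V /\ V x /\ forall y, V y -> U y.

Definition zero_dimensional (X : TopSpace) : Prop := is_base X (clopen X).

Definition compact (X : TopSpace) : Prop :=
  forall F : (X -> Prop) -> Prop, (forall U, F U -> is_open U) ->
    (forall x, exists U, F U /\ U x) ->
    exists l : list (X -> Prop), (forall U, In U l -> F U) /\
      forall x, exists U, In U l /\ U x.

Definition hausdorff (X : TopSpace) : Prop :=
  forall x y : X, x <> y -> exists U V, is_open U /\ is_open V /\ U x /\ V y /\
    forall z, ~ (U z /\ V z).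

Definition no_isolated_points (X : TopSpace) : Prop :=
  forall x : X, ~ is_open (fun y => y = x).

Definition le_card (A B : Type) : Prop :=
  exists f : A -> B, forall a a', f a = f a' -> a = a'.
Definition lt_card (A B : Type) : Prop := le_card A B /\ ~ le_card B A.
Definition eq_card (A B : Type) : Prop :=
  exists (f : A -> B) (g : B -> A), (forall a, g (f a) = a) /\ (forall b, f (g b) = b).

(* κ = κ^{<κ}, κ infinite: κ^{<κ} is represented by the set of partial
   functions κ ⇀ κ with domain of cardinality < κ. *)
Definition kappa_eq_kappa_lt (K : Type) : Prop :=
  le_card nat K /\
  eq_card {f : K -> option K | lt_card {k : K | f k <> None} K} K.

Definition type_lt (K : Type) (X : TopSpace) (U : X -> Prop) : Prop :=
  exists F : (X -> Prop) -> Prop, (forall V, F V -> clopen X V) /\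
    lt_card {V : X -> Prop | F V} K /\
    forall x, U x <-> exists V, F V /\ V x.

Definition C_star_embedded (X : TopSpace) (U : X -> Prop) : Prop :=
  forall f : subspace X U -> R, continuous_R (subspace X U) f -> bounded_R _ f ->
    exists g : X -> R, continuous_R X g /\ forall y, g (proj1_sig y) = f y.

Definition F_kappa_space (K : Type) (X : TopSpace) : Prop :=
  zero_dimensional X /\
  forall U, is_open U -> type_lt K X U -> C_star_embedded X U.

Definition G_kappa_space (K : Type) (X : TopSpace) : Prop :=
  forall F : (X -> Prop) -> Prop, (forall U, F U -> is_open U) ->
    lt_card {U : X -> Prop | F U} K ->
    (exists x, forall U, F U -> U x) ->
    exists W, is_open W /\ (exists x, W x) /\ forall x, W x -> forall U, F U -> U x.

Definition kappa_Parovicenko (K : Type) (X : TopSpace) : Prop :=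
  compact X /\ hausdorff X /\ zero_dimensional X /\
  F_kappa_space K X /\ G_kappa_space K X /\ no_isolated_points X.

Definition weight_is (X : TopSpace) (C : Type) : Prop :=
  (exists B, is_base X B /\ le_card {U : X -> Prop | B U} C) /\
  forall B, is_base X B -> le_card C {U : X -> Prop | B U}.

Definition embedding (X Y : TopSpace) (e : X -> Y) : Prop :=
  continuous X Y e /\ (forall a b, e a = e b -> a = b) /\
  forall U, is_open U -> exists V, is_open V /\ forall x, U x <-> V (e x).

Definition is_stone_cech (X Y : TopSpace) (e : X -> Y) : Prop :=
  compact Y /\ hausdorff Y /\ embedding X Y e /\
  (forall V, is_open V -> (exists y, V y) -> exists x, V (e x)) /\
  forall f : X -> R, continuous_R X f -> bounded_R _ f ->
    exists g : Y -> R, continuous_R Y g /\ forall x, g (e x) = f x.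

(* Main.v *)
(** Put X = S \ {x}.  It is a union of clopen sets C_k (k in K), and K is well-ordered with all
    proper initial segments smaller than K, so every initial union of the C_k is open of type < K.
    Hence a continuous function on an open P of X, such that every trace of P on C_k has type < K,
    extends to X by transfinite recursion, using the F_K-property of S at each stage.

    - Applied to real functions on traces of open sets of type < K, this makes βX an F_K-space.
    - Applied to the indicator of one of two disjoint open F_sigma sets separating two points of βX,
      it gives zero-dimensionality (for K = ω one disjointifies the C_k instead).
    - There are disjoint nonempty clopen A_k in X that leave every C_j; any subset of K is cut out by
      a clopen subset of βX containing exactly the corresponding A_k.  A family of 2^K subsets of K,
      none covered by finitely many others, yields 2^K points of βX each in its own clopen set and
      in no other, so every base has at least 2^K members.
    - A cover of X by fewer than K clopen subsets of X has a finite subcover.  Hence a nonempty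
      intersection of fewer than K clopen subsets of βX meets X, and βX inherits the G_K-property. *)

From mathcomp Require boolp wochoice.
From Stdlib Require Import Reals List Lra Lia Wellfounded.
From Stdlib Require Import Classical ClassicalEpsilon.
From Stdlib Require Import FunctionalExtensionality PropExtensionality.
Require Import Defs.

(** * Well-orders and choice *)

Lemma pred_ext {A : Type} (P Q : A -> Prop) : (forall a, P a <-> Q a) -> P = Q.
Proof.
  intros H. apply functional_extensionality. intros a.
  apply propositional_extensionality, H.
Qed.

Lemma choice_fun {A B : Type} (R : A -> B -> Prop) :
  (forall a, exists b, R a b) -> exists f : A -> B, forall a, R a (f a).
Proof.
  intros H.
  exists (fun a => proj1_sig (constructive_indefinite_description _ (H a))).
  intros a. exact (proj2_sig (constructive_indefinite_description _ (H a))).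
Qed.

Definition well_ordered {T : Type} (lt : T -> T -> Prop) : Prop :=
  well_founded lt /\ (forall a b c, lt a b -> lt b c -> lt a c) /\
  (forall a b, lt a b \/ a = b \/ lt b a).

Lemma wf_min {T : Type} (lt : T -> T -> Prop) : well_founded lt ->
  forall P : T -> Prop, (exists a, P a) -> exists a, P a /\ forall b, lt b a -> ~ P b.
Proof.
  intros W P [a Ha]. apply NNPP. intros N. revert Ha.
  induction (W a) as [a _ IH]. intros Ha. apply N. exists a. split; auto.
Qed.

Lemma well_order_exists (T : Type) : exists lt : T -> T -> Prop, well_ordered lt.
Proof.
  assert (M0 : exists R : T -> T -> bool, forall P : T -> Prop, (exists a, P a) ->
             exists a, (P a /\ forall b, P b -> R a b = true) /\
               forall a', (P a' /\ forall b, P b -> R a' b = true) -> a = a').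
  (* [boolp.Peq] supplies the equality structure that the well-ordering principle expects of its
     type. *)
  { pattern T. apply boolp.Peq. clear T. intros T.
    destruct (wochoice.well_ordering_principle T) as [R HR]. exists R.
    intros P [a Ha].
    assert (I : forall t, P t <-> boolp.asbool (P t) = true).
    { intros t. apply Bool.reflect_iff, boolp.asboolP. }
    destruct (HR (fun t => boolp.asbool (P t))) as [m [[Hm1 Hm2] Hm3]].
    - exists a. apply I, Ha.
    - exists m. split; [split|].
      + apply I, Hm1.
      + intros b Hb. apply Hm2, I, Hb.
      + intros a' [H1 H2]. apply Hm3. split; [apply I, H1|].
        intros b Hb. apply H2, I, Hb. }
  destruct M0 as [R M0].
  assert (M : forall P : T -> Prop, (exists a, P a) ->
             exists a, P a /\ forall b, P b -> R a b = true).
  { intros P HP. destruct (M0 P HP) as [a [Ha _]]. exists a. exact Ha. }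
  (* Antisymmetry comes from the uniqueness of the minimum of the pair {a, b}, of which both points
     would be minima. *)
  assert (A : forall a b, R a b = true -> R b a = true -> a = b).
  { intros a b Hab Hba.
    assert (Raa : forall c, R c c = true).
    { intros c. destruct (M (fun t => t = c)) as [m [-> Hm]]; [eauto|]. apply Hm. reflexivity. }
    destruct (M0 (fun t => t = a \/ t = b)) as [m [_ Hm]]; [eauto|].
    transitivity m; [symmetry|]; apply Hm; split; auto;
      intros c [-> | ->]; auto. }
  exists (fun a b => R a b = true /\ a <> b).
  assert (W : well_founded (fun a b => R a b = true /\ a <> b)).
  { intros a. apply NNPP. intros N.
    destruct (M (fun t => ~ Acc (fun a b => R a b = true /\ a <> b) t)) as [m [Hm1 Hm2]].
    - exists a. exact N.
    - apply Hm1. constructor. intros b [Hb1 Hb2]. apply NNPP. intros Nb.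
      apply Hb2, A; auto. }
  assert (T3 : forall a b, (R a b = true /\ a <> b) \/ a = b \/ (R b a = true /\ b <> a)).
  { intros a b. destruct (classic (a = b)) as [E|E]; [auto|].
    destruct (M (fun t => t = a \/ t = b)) as [m [[-> | ->] Hm]]; [eauto| |].
    - left. split; auto.
    - right; right. split; auto. }
  split; [exact W|]. split; [|exact T3].
  intros a b c Hab Hbc.
  destruct (M (fun t => t = a \/ t = b \/ t = c)) as [m [Hm1 Hm2]]; [eauto|].
  assert (Ra := Hm2 a (or_introl eq_refl)).
  assert (Rb := Hm2 b (or_intror (or_introl eq_refl))).
  assert (Rc := Hm2 c (or_intror (or_intror eq_refl))).
  destruct Hab as [Hab Nab], Hbc as [Hbc Nbc].
  destruct Hm1 as [-> | [-> | ->]].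
  - split; [exact Rc|]. intros ->. apply Nab, A; assumption.
  - exfalso. apply Nab, A; assumption.
  - exfalso. apply Nbc, A; assumption.
Qed.

(** * Cardinal arithmetic below K *)

Lemma le_card_trans (A B C : Type) : le_card A B -> le_card B C -> le_card A C.
Proof. intros [f Hf] [g Hg]. exists (fun a => g (f a)). auto. Qed.

Lemma le_lt_card (A B C : Type) : le_card A B -> lt_card B C -> lt_card A C.
Proof.
  intros H [H1 H2]. split; [eapply le_card_trans; eauto|].
  intros H3. apply H2. eapply le_card_trans; eauto.
Qed.

Lemma le_card_sub {A : Type} (P Q : A -> Prop) :
  (forall a, P a -> Q a) -> le_card {a | P a} {a | Q a}.
Proof.
  intros H. exists (fun a => exist Q (proj1_sig a) (H _ (proj2_sig a))).
  intros [a Ha] [b Hb] E. apply eq_sig_hprop.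
  - intros c p q. apply proof_irrelevance.
  - inversion E. assumption.
Qed.

Lemma le_card_surj {A B : Type} (f : A -> B) : (forall b, exists a, f a = b) -> le_card B A.
Proof.
  intros H. destruct (choice_fun _ H) as [g Hg]. exists g.
  intros b b' E. rewrite <- (Hg b), <- (Hg b'), E. reflexivity.
Qed.

Lemma le_card_image {A B : Type} (f : A -> B) : le_card {b | exists a, f a = b} A.
Proof.
  apply (le_card_surj (fun a => exist (fun b => exists a, f a = b) (f a) (ex_intro _ a eq_refl))).
  intros [b [a <-]]. exists a. reflexivity.
Qed.

Lemma sig_eq {A : Type} (P : A -> Prop) (a b : A) (p : P a) (q : P b) :
  a = b -> exist P a p = exist P b q.
Proof. intros ->. f_equal. apply proof_irrelevance. Qed.

(* Pulling the well-order back along an injection into the least initial segment of full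
   cardinality makes all proper initial segments small. *)
Lemma initial_well_order (K : Type) : exists lt : K -> K -> Prop,
  well_ordered lt /\ forall k, lt_card {j | lt j k} K.
Proof.
  destruct (well_order_exists K) as [lt [W [Tr T3]]].
  assert (LS : forall k, le_card {j | lt j k} K).
  { intros k. exists (@proj1_sig _ _). intros [a Ha] [b Hb]. apply sig_eq. }
  destruct (classic (exists k, le_card K {j | lt j k})) as [E|E].
  - destruct (wf_min lt W _ E) as [m [[f Hf] Hm]].
    set (g := fun k => proj1_sig (f k)).
    assert (Hg : forall a b, g a = g b -> a = b).
    { intros a b H. apply Hf. unfold g in H. destruct (f a), (f b). apply sig_eq, H. }
    exists (fun a b => lt (g a) (g b)). split; [split; [|split]|].
    + apply wf_inverse_image, W.
    + intros a b c. apply Tr.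
    + intros a b. destruct (T3 (g a) (g b)) as [H|[H|H]]; auto.
    + assert (L : forall k, le_card {j | lt (g j) (g k)} {j | lt j (g k)}).
      { intros k. exists (fun j : {j | lt (g j) (g k)} =>
          exist (fun j => lt j (g k)) (g (proj1_sig j)) (proj2_sig j)).
        intros [a Ha] [b Hb] H. apply sig_eq, Hg. exact (f_equal (@proj1_sig _ _) H). }
      intros k. split.
      * eapply le_card_trans; [apply L | apply LS].
      * intros H. apply (Hm (g k)); [exact (proj2_sig (f k))|].
        eapply le_card_trans; [exact H | apply L].
  - exists lt. split; [exact (conj W (conj Tr T3))|]. intros k. split; [apply LS|].
    intros H. apply E. exists k. exact H.
Qed.

(** Dependent choice along a well-order. Since [R k h] looks at [h] below [k] only, a value can be
    picked by [epsilon] at each stage, and the existence hypothesis may assume that all earlier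
    picks were correct. *)
Lemma wf_choice {K A : Type} (lt : K -> K -> Prop) (R : K -> (K -> A) -> A -> Prop) :
  well_founded lt -> inhabited A ->
  (forall k h h' a, (forall j, lt j k -> h j = h' j) -> R k h a -> R k h' a) ->
  (forall k h, (forall j, lt j k -> R j h (h j)) -> exists a, R k h a) ->
  exists g : K -> A, forall k, R k g (g k).
Proof.
  intros W inh Ext Ex.
  (* [Fix] hands over the values below [k] only; [ext] pads them to a total function, with an
     arbitrary value that [Ext] makes harmless. *)
  set (ext := fun k (r : forall j, lt j k -> A) (j : K) =>
    match excluded_middle_informative (lt j k) with
    | left p => r j p
    | right _ => epsilon inh (fun _ => True)
    end).
  set (F := fun k (r : forall j, lt j k -> A) => epsilon inh (R k (ext k r))).
  set (g := Fix W (fun _ => A) F).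
  assert (Hg : forall k, g k = F k (fun j _ => g j)).
  { intros k. unfold g. rewrite Fix_eq; [reflexivity|].
    intros k' r r' H. f_equal. apply functional_extensionality_dep. intros j.
    apply functional_extensionality. intros p. apply H. }
  assert (He : forall k j, lt j k -> ext k (fun j _ => g j) j = g j).
  { intros k j H. unfold ext. destruct (excluded_middle_informative (lt j k)); tauto. }
  exists g. intros k. induction (W k) as [k _ IH].
  assert (E : exists a, R k (ext k (fun j _ => g j)) a).
  { destruct (Ex k g IH) as [a Ha]. exists a. eapply Ext; [|exact Ha].
    intros j Hj. symmetry. apply He, Hj. }
  apply (epsilon_spec inh) in E.
  rewrite Hg. unfold F at 1. eapply Ext; [|exact E]. apply He.
Qed.
(** Transporting a function along an injection of [I] into [K] gives a partial function on [K] with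
    domain smaller than [K], and these number only [K] by assumption. *)
Lemma kappa_functions (K I : Type) : kappa_eq_kappa_lt K -> lt_card I K -> le_card (I -> K) K.
Proof.
  intros [_ [f [g [gf _]]]] HI. destruct HI as [[i Hi] HI].
  assert (Ex : forall u : I -> K, exists v : K -> option K,
            (forall a, v (i a) = Some (u a)) /\ forall k, v k <> None -> exists a, i a = k).
  { intros u.
    destruct (choice_fun (fun k o => (exists a, i a = k /\ o = Some (u a)) \/
                                     ((~ exists a, i a = k) /\ o = None))) as [v Hv].
    { intros k. destruct (classic (exists a, i a = k)) as [[a Ha]|N]; eauto. }
    exists v. split.
    - intros a. destruct (Hv (i a)) as [[b [Hb ->]]|[N _]]; [|exfalso; eauto].
      f_equal. f_equal. apply Hi, Hb.
    - intros k Hk. destruct (Hv k) as [[a [Ha _]]|[_ N]]; [eauto|tauto]. }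
  apply choice_fun in Ex. destruct Ex as [v Hv].
  assert (D : forall u, lt_card {k | v u k <> None} K).
  { intros u. apply le_lt_card with I; [|split; [exists i; exact Hi|exact HI]].
    apply le_card_trans with {k | exists a, i a = k}; [|apply le_card_image].
    apply le_card_sub, (proj2 (Hv u)). }
  exists (fun u => f (exist _ (v u) (D u))).
  intros u u' E. apply (f_equal g) in E. rewrite !gf in E.
  apply (f_equal (@proj1_sig _ _)) in E. simpl in E.
  apply functional_extensionality. intros a.
  assert (H := proj1 (Hv u) a). rewrite E, (proj1 (Hv u')) in H. congruence.
Qed.

(* König's argument: [K] maps onto [I -> K], and one avoids each [A i] in its own coordinate. *)
Lemma kappa_regular (K I : Type) (A : I -> K -> Prop) :
  kappa_eq_kappa_lt K -> lt_card I K -> (forall i, lt_card {k | A i k} K) ->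
  exists k, forall i, ~ A i k.
Proof.
  intros HK HI HA. destruct (kappa_functions K I HK HI) as [c Hc].
  destruct (choice_fun (fun k (u : I -> K) => forall w, c w = k -> u = w)) as [p Hp].
  { intros k. destruct (classic (exists w, c w = k)) as [[w Hw]|N].
    - exists w. intros w' Hw'. apply Hc. congruence.
    - exists (fun _ => k). intros w Hw. exfalso. eauto. }
  destruct (choice_fun (fun i u => forall k, A i k -> p k i <> u)) as [u Hu].
  { intros i. apply NNPP. intros N. apply (proj2 (HA i)).
    apply (le_card_surj (fun k => p (proj1_sig k) i)). intros u. apply NNPP. intros N'.
    apply N. exists u. intros k Hk E. apply N'. exists (exist _ k Hk). exact E. }
  exists (c u). intros i Hi. apply (Hu i _ Hi). rewrite (Hp (c u) u eq_refl). reflexivity.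
Qed.

Lemma kappa_bool (K : Type) : kappa_eq_kappa_lt K -> lt_card bool K.
Proof.
  intros [HN _]. split.
  - apply le_card_trans with nat; [|exact HN].
    exists (fun b : bool => if b then 1%nat else 0%nat). intros [] []; congruence.
  - intros H. destruct (le_card_trans _ _ _ HN H) as [f Hf].
    assert (H01 : f 0%nat <> f 1%nat) by (intros E; apply Hf in E; discriminate).
    assert (H02 : f 0%nat <> f 2%nat) by (intros E; apply Hf in E; discriminate).
    assert (H12 : f 1%nat <> f 2%nat) by (intros E; apply Hf in E; discriminate).
    destruct (f 0%nat), (f 1%nat), (f 2%nat); congruence.
Qed.

Lemma kappa_sum (K A B : Type) : kappa_eq_kappa_lt K ->
  lt_card A K -> lt_card B K -> lt_card (A + B) K.
Proof.
  intros HK HA HB. assert (Hb := kappa_bool K HK). split.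
  - apply le_card_trans with (bool -> K); [|apply kappa_functions; assumption].
    destruct HA as [[f Hf] _], HB as [[g Hg] _], Hb as [[h Hh] _].
    exists (fun (s : A + B) (b : bool) => match s with
                       | inl a => if b then f a else h true
                       | inr a => if b then g a else h false end).
    intros s t E. assert (E0 := equal_f E true). assert (E1 := equal_f E false). simpl in *.
    destruct s, t; try (f_equal; auto; fail); apply Hh in E1; discriminate.
  (* An injection of [K] into the sum would split [K] into two small pieces, against regularity. *)
  - intros [f Hf].
    destruct (kappa_regular K bool (fun b k => if b then exists a, f k = inl a
                                    else exists a, f k = inr a) HK Hb) as [k Hk].
    + intros []; [apply le_lt_card with A | apply le_lt_card with B]; try assumption;
        [ destruct (choice_fun (fun (k : {k | exists a, f k = inl a}) a => f (proj1_sig k) = inl a))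
            as [g Hg]
        | destruct (choice_fun (fun (k : {k | exists a, f k = inr a}) a => f (proj1_sig k) = inr a))
            as [g Hg] ];
        try (intros [k Hk]; exact Hk);
        exists g; intros [a Ha] [b Hb'] E;
        assert (H1 := Hg (exist _ a Ha)); assert (H2 := Hg (exist _ b Hb')); simpl in *;
        apply sig_eq, Hf; congruence.
    + destruct (f k) as [a|b] eqn:E; [apply (Hk true)|apply (Hk false)]; eauto.
Qed.

Lemma kappa_unbounded (K : Type) (lt : K -> K -> Prop) : kappa_eq_kappa_lt K ->
  well_ordered lt -> (forall k, lt_card {j | lt j k} K) ->
  forall l : list K, exists k, forall j, In j l -> lt j k.
Proof.
  intros HK [W [Tr T3]] Sm.
  (* There is no largest element: otherwise [K] would be the union of a proper initial segment and
     one point, against regularity. *)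
  assert (Nx : forall m, exists k, lt m k).
  { intros m.
    destruct (kappa_regular K bool (fun b k => if b then lt k m else k = m) HK (kappa_bool K HK))
      as [k Hk].
    - intros []; [apply Sm|]. apply le_lt_card with bool; [|apply kappa_bool, HK].
      exists (fun _ => true). intros [a ->] [b ->] _. reflexivity.
    - exists k. destruct (T3 k m) as [H|[H|H]]; [|  |exact H]; exfalso;
        [apply (Hk true)|apply (Hk false)]; exact H. }
  destruct (HK) as [[n _] _].
  induction l as [|a l [k Hk]].
  - exists (n 0%nat). intros j [].
  - destruct (T3 a k) as [H|[H|H]]; destruct (Nx k) as [k' Hk'], (Nx a) as [a' Ha'].
    + exists k. intros j [<-|Hj]; auto.
    + exists k'. intros j [<-|Hj]; [subst; auto|]. eauto.
    + exists a'. intros j [<-|Hj]; eauto.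
Qed.

(* [E s] consists of codes of the restrictions of [s] to initial segments, so [E s] and [E t] share
   no code of a restriction reaching past the first difference of [s] and [t]. *)
Lemma finitely_independent_sets (K : Type) (lt : K -> K -> Prop) : kappa_eq_kappa_lt K ->
  well_ordered lt -> (forall k, lt_card {j | lt j k} K) ->
  exists E : (K -> bool) -> K -> Prop, forall s l, (forall t, In t l -> t <> s) ->
    exists k, E s k /\ forall t, In t l -> ~ E t k.
Proof.
  intros HK WO Sm. destruct (kappa_bool K HK) as [[b Hb] _].
  assert (HK' := HK). destruct HK' as [_ [f [g [gf _]]]].
  set (r := fun (s : K -> bool) a k =>
    if excluded_middle_informative (lt k a) then Some (b (s k)) else None).
  assert (D : forall s a, lt_card {k | r s a k <> None} K).
  { intros s a. apply le_lt_card with {j | lt j a}; [|apply Sm]. apply le_card_sub.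
    intros k. unfold r. destruct (excluded_middle_informative (lt k a)); tauto. }
  exists (fun s k => exists a, f (exist _ (r s a) (D s a)) = k).
  intros s l Hl.
  assert (Bd : exists l', forall t, In t l -> exists d, In d l' /\ s d <> t d).
  { induction l as [|t l IH]; [exists nil; intros t []|].
    destruct IH as [l' Hl']; [intros u Hu; apply Hl; simpl; auto|].
    assert (Hd : exists d, s d <> t d).
    { apply NNPP. intros N. apply (Hl t (or_introl eq_refl)). apply functional_extensionality.
      intros d. apply NNPP. intros Nd. apply N. exists d. congruence. }
    destruct Hd as [d Hd]. exists (d :: l'). intros u [<-|Hu].
    - exists d. simpl. auto.
    - destruct (Hl' u Hu) as [d' [H1 H2]]. exists d'. simpl. auto. }
  destruct Bd as [l' Hl'].
  destruct (kappa_unbounded K lt HK WO Sm l') as [a Ha].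
  exists (f (exist _ (r s a) (D s a))). split; [eauto|].
  intros t Ht [a' E]. destruct (Hl' t Ht) as [d [Hd Nd]].
  apply (f_equal g) in E. rewrite !gf in E. apply (f_equal (@proj1_sig _ _)) in E. simpl in E.
  apply (f_equal (fun v => v d)) in E. unfold r in E.
  destruct (excluded_middle_informative (lt d a)) as [_|N]; [|exact (N (Ha d Hd))].
  destruct (excluded_middle_informative (lt d a')); [|discriminate].
  injection E as E. apply Hb in E. congruence.
Qed.

(** * Compact zero-dimensional spaces *)

Section Topology.
Context {X : TopSpace}.
Implicit Types U V A B : X -> Prop.

Lemma open_eq U V : (forall p, U p <-> V p) -> is_open U -> is_open V.
Proof. intros H. rewrite (pred_ext _ _ H). auto. Qed.

Lemma open_Union {I : Type} (N : I -> X -> Prop) :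
  (forall i, is_open (N i)) -> is_open (fun p => exists i, N i p).
Proof.
  intros H. apply open_eq with (fun p => exists U, (exists i, N i = U) /\ U p).
  - intros p. split; [intros [U [[i <-] Hp]] | intros [i Hp]]; eauto.
  - apply open_union. intros U [i <-]. apply H.
Qed.

Lemma open_local U :
  (forall p, U p -> exists V, is_open V /\ V p /\ forall q, V q -> U q) -> is_open U.
Proof.
  intros H. apply open_eq with (fun p => exists V, (is_open V /\ forall q, V q -> U q) /\ V p).
  - intros p. split; [intros [V [[_ HV] Hp]]; auto|].
    intros Hp. destruct (H p Hp) as [V HV]. exists V. tauto.
  - apply open_union. tauto.
Qed.

Lemma open_or U V : is_open U -> is_open V -> is_open (fun p => U p \/ V p).
Proof.
  intros HU HV. apply open_local. intros p [H|H]; [exists U|exists V]; auto.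
Qed.

Lemma open_const (P : Prop) : is_open (fun _ : X => P).
Proof. apply open_local. intros p Hp. exists (fun _ => True). split; [apply open_full|auto]. Qed.

Lemma open_list_inter {I : Type} (N : I -> X -> Prop) (l : list I) :
  (forall i, is_open (N i)) -> is_open (fun p => forall i, In i l -> N i p).
Proof.
  intros H. induction l as [|i l IH].
  - apply open_eq with (fun _ => True); [|apply open_full]. intros p. split; [intros _ i []|auto].
  - apply open_eq with (2 := open_inter X _ _ (H i) IH). intros p. simpl. split.
    + intros [H1 H2] j [<-|Hj]; auto.
    + intros H1. split; auto.
Qed.

Lemma clopen_compl U : clopen X U -> clopen X (fun p => ~ U p).
Proof.
  intros [H1 H2]. split; [exact H2|]. apply open_eq with U; [|exact H1].
  intros p. split; [tauto|apply NNPP].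
Qed.

Lemma clopen_and U V : clopen X U -> clopen X V -> clopen X (fun p => U p /\ V p).
Proof.
  intros [H1 H2] [H3 H4]. split; [apply open_inter; assumption|].
  apply open_eq with (2 := open_or _ _ H2 H4). intros p. tauto.
Qed.

Lemma clopen_or U V : clopen X U -> clopen X V -> clopen X (fun p => U p \/ V p).
Proof.
  intros [H1 H2] [H3 H4]. split; [apply open_or; assumption|].
  apply open_eq with (2 := open_inter X _ _ H2 H4). intros p. tauto.
Qed.

Lemma clopen_const (P : Prop) : clopen X (fun _ => P).
Proof. split; apply open_const. Qed.

Lemma clopen_list_or {I : Type} (N : I -> X -> Prop) (l : list I) :
  (forall i, In i l -> clopen X (N i)) -> clopen X (fun p => exists i, In i l /\ N i p).
Proof.
  intros H. induction l as [|i l IH].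
  - replace (fun p => exists i, In i nil /\ N i p) with (fun _ : X => False).
    + apply clopen_const.
    + apply pred_ext. intros p. split; [tauto|intros [i [[] _]]].
  - replace (fun p => exists j, In j (i :: l) /\ N j p)
      with (fun p => N i p \/ exists j, In j l /\ N j p).
    + apply clopen_or; [apply H; simpl; auto|]. apply IH. intros j Hj. apply H. simpl. auto.
    + apply pred_ext. intros p. simpl. split.
      * intros [Hp|[j [Hj Hp]]]; eauto.
      * intros [j [[<-|Hj] Hp]]; eauto.
Qed.

Lemma compact_closed {I : Type} (N : I -> X -> Prop) A : compact X ->
  is_open (fun p => ~ A p) -> (forall i, is_open (N i)) ->
  (forall p, A p -> exists i, N i p) ->
  exists l : list I, forall p, A p -> exists i, In i l /\ N i p.
Proof.
  intros HX HA HN Cov.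
  destruct (HX (fun U => (exists i, N i = U) \/ U = (fun p => ~ A p))) as [l [Hl Hc]].
  - intros U [[i <-]| ->]; auto.
  - intros p. destruct (classic (A p)) as [Hp|Hp].
    + destruct (Cov p Hp) as [i Hi]. eauto.
    + exists (fun p => ~ A p). auto.
  - assert (L : exists l' : list I, forall i U, In U l -> N i = U -> exists j, In j l' /\ N j = U).
    { clear Hc. induction l as [|U l IH].
      - exists nil. intros i U [].
      - destruct IH as [l' Hl']; [intros V HV; apply Hl; simpl; auto|].
        destruct (classic (exists i, N i = U)) as [[i Hi]|Ni].
        + exists (i :: l'). intros j V [<-|HV] E; [exists i; simpl; auto|].
          destruct (Hl' j V HV E) as [m [Hm1 Hm2]]. exists m. simpl. auto.
        + exists l'. intros j V [<-|HV] E; [exfalso; eauto|]. eauto. }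
    destruct L as [l' Hl']. exists l'. intros p Hp.
    destruct (Hc p) as [U [HU Up]]. destruct (Hl U HU) as [[i Hi]| ->]; [|tauto].
    destruct (Hl' i U HU Hi) as [j [Hj1 <-]]. eauto.
Qed.

Lemma clopen_between A U : compact X -> zero_dimensional X ->
  is_open (fun p => ~ A p) -> is_open U -> (forall p, A p -> U p) ->
  exists E, clopen X E /\ (forall p, A p -> E p) /\ forall p, E p -> U p.
Proof.
  intros HX [_ HZ] HA HU HAU.
  destruct (compact_closed (fun i : {V | clopen X V /\ forall p, V p -> U p} => proj1_sig i) A)
    as [l Hl]; auto.
  - intros [V HV]. apply HV.
  - intros p Hp. destruct (HZ U HU p (HAU p Hp)) as [V [HV [Vp VU]]].
    exists (exist _ V (conj HV VU)). exact Vp.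
  - exists (fun p => exists i, In i l /\ proj1_sig i p). split; [|split; [exact Hl|]].
    + apply clopen_list_or. intros [V HV] _. apply HV.
    + intros p [[V HV] [_ Vp]]. apply HV, Vp.
Qed.

Lemma clopen_nbhd U p : zero_dimensional X -> is_open U -> U p ->
  exists V, clopen X V /\ V p /\ forall q, V q -> U q.
Proof. intros [_ H] HU Hp. apply H; assumption. Qed.

Lemma hausdorff_closed_point (p : X) : hausdorff X -> is_open (fun q => q <> p).
Proof.
  intros H. apply open_local. intros q Hq. destruct (H q p Hq) as [U [V [HU [_ [Uq [Vp D]]]]]].
  exists U. split; [exact HU|split; [exact Uq|]]. intros r Hr ->. apply (D p). auto.
Qed.

Lemma closed_point_separation A p : compact X -> hausdorff X -> is_open (fun q => ~ A q) -> ~ A p ->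
  exists U V, is_open U /\ is_open V /\ (forall q, A q -> U q) /\ V p /\ forall q, ~ (U q /\ V q).
Proof.
  intros HX HH HA Hp.
  set (J := {UV : (X -> Prop) * (X -> Prop) | is_open (fst UV) /\ is_open (snd UV) /\
               snd UV p /\ forall q, ~ (fst UV q /\ snd UV q)}).
  destruct (compact_closed (fun i : J => fst (proj1_sig i)) A) as [l Hl]; auto.
  - intros [UV H]. apply H.
  - intros q Hq. destruct (HH q p) as [U [V [HU [HV [Uq [Vp D]]]]]]; [congruence|].
    exists (exist _ (U, V) (conj HU (conj HV (conj Vp D)))). exact Uq.
  - exists (fun q => exists i : J, In i l /\ fst (proj1_sig i) q).
    exists (fun q => forall i : J, In i l -> snd (proj1_sig i) q).
    repeat split.
    + apply open_Union. intros i. apply open_inter; [apply open_const|].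
      destruct i as [UV H]. apply H.
    + apply open_list_inter. intros [UV H]. apply H.
    + exact Hl.
    + intros [UV H] _. apply H.
    + intros q [[i [Hi Hq]] Hq']. specialize (Hq' i Hi). destruct i as [UV H]. simpl in *.
      apply (proj2 (proj2 (proj2 H)) q). auto.
Qed.

Lemma compact_hausdorff_normal A B : compact X -> hausdorff X ->
  is_open (fun q => ~ A q) -> is_open (fun q => ~ B q) -> (forall q, ~ (A q /\ B q)) ->
  exists U V, is_open U /\ is_open V /\ (forall q, A q -> U q) /\ (forall q, B q -> V q) /\
    forall q, ~ (U q /\ V q).
Proof.
  intros HX HH HA HB D.
  set (J := {UV : (X -> Prop) * (X -> Prop) | is_open (fst UV) /\ is_open (snd UV) /\
               (forall q, A q -> fst UV q) /\ forall q, ~ (fst UV q /\ snd UV q)}).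
  destruct (compact_closed (fun i : J => snd (proj1_sig i)) B) as [l Hl]; auto.
  - intros [UV H]. apply H.
  - intros p Hp. destruct (closed_point_separation A p) as [U [V [HU [HV [AU [Vp D']]]]]]; auto.
    + intros Ap. apply (D p). auto.
    + exists (exist _ (U, V) (conj HU (conj HV (conj AU D')))). exact Vp.
  - exists (fun q => forall i : J, In i l -> fst (proj1_sig i) q).
    exists (fun q => exists i : J, In i l /\ snd (proj1_sig i) q).
    repeat split.
    + apply open_list_inter. intros [UV H]. apply H.
    + apply open_Union. intros i. apply open_inter; [apply open_const|].
      destruct i as [UV H]. apply H.
    + intros q Hq [UV H] _. apply H, Hq.
    + exact Hl.
    + intros q [Hq' [i [Hi Hq]]]. specialize (Hq' i Hi). destruct i as [UV H]. simpl in *.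
      apply (proj2 (proj2 (proj2 H)) q). auto.
Qed.

(** Normality is used twice: first [G] and [V] separate [A] from [B], then [W] and [H] separate the
    complement of [V] from [B]. The complements of [V] and [W] are again disjoint closed sets, so
    the step can be iterated. *)
Lemma normal_step A B : compact X -> hausdorff X ->
  is_open (fun q => ~ A q) -> is_open (fun q => ~ B q) -> (forall q, ~ (A q /\ B q)) ->
  exists G H A' B', is_open G /\ is_open H /\
    is_open (fun q => ~ A' q) /\ is_open (fun q => ~ B' q) /\
    (forall q, A q -> G q) /\ (forall q, G q -> A' q) /\
    (forall q, B q -> H q) /\ (forall q, H q -> B' q) /\ (forall q, ~ (A' q /\ B' q)).
Proof.
  intros HX HH HA HB D.
  destruct (compact_hausdorff_normal A B) as [G [V [HG [HV [AG [BV D1]]]]]]; auto.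
  destruct (compact_hausdorff_normal (fun q => ~ V q) B) as [W [H [HW [HH' [VW [BH D2]]]]]]; auto.
  - apply open_eq with V; [|exact HV]. intros q. split; [tauto|apply NNPP].
  - intros q [H1 H2]. auto.
  - exists G, H, (fun q => ~ V q), (fun q => ~ W q). repeat split; auto.
    + apply open_eq with V; [|exact HV]. intros q. split; [tauto|apply NNPP].
    + apply open_eq with W; [|exact HW]. intros q. split; [tauto|apply NNPP].
    + intros q Gq Vq. apply (D1 q). auto.
    + intros q Hq Wq. apply (D2 q). auto.
    + intros q [H1 H2]. auto.
Qed.

Lemma clopen_separation_zero_dimensional : compact X ->
  (forall p q, p <> q -> exists V, clopen X V /\ V p /\ ~ V q) -> zero_dimensional X.
Proof.
  intros HX Sep. split; [intros U HU; apply HU|]. intros U HU p Up.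
  destruct (compact_closed (fun i : {V | clopen X V /\ ~ V p} => proj1_sig i) (fun q => ~ U q))
    as [l Hl]; auto.
  - apply open_eq with U; [|exact HU]. intros q. split; [tauto|apply NNPP].
  - intros [V HV]. apply HV.
  - intros q Hq. destruct (Sep q p) as [V [HV [Vq Vp]]]; [congruence|].
    exists (exist _ V (conj HV Vp)). exact Vq.
  - exists (fun q => ~ exists i : {V | clopen X V /\ ~ V p}, In i l /\ proj1_sig i q).
    split; [|split].
    + apply clopen_compl, clopen_list_or. intros [V HV] _. apply HV.
    + intros [[V HV] [_ Vp]]. exact (proj2 HV Vp).
    + intros q Hq. apply NNPP. intros N. apply Hq, Hl, N.
Qed.

(** For open [U] this is continuity of the restriction to [U]. Total functions avoid maps between
    subtypes when pieces are glued, and the family [O] lets one development serve real and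
    two-valued targets. *)
Definition continuous_on {T : Type} (O : (T -> Prop) -> Prop) U (f : X -> T) : Prop :=
  forall Q : T -> Prop, O Q -> is_open (fun p => U p /\ Q (f p)).

Context {T : Type} (O : (T -> Prop) -> Prop).
Implicit Types f g : X -> T.

Lemma continuous_on_eq U f g : (forall p, U p -> f p = g p) ->
  continuous_on O U f -> continuous_on O U g.
Proof.
  intros E H V HV. apply open_eq with (2 := H V HV). intros p.
  split; intros [Up Vp]; (split; [exact Up|]); [rewrite <- E|rewrite E]; assumption.
Qed.

Lemma continuous_on_sub U V f : is_open V -> (forall p, V p -> U p) ->
  continuous_on O U f -> continuous_on O V f.
Proof.
  intros HV HVU H W HW. apply open_eq with (2 := open_inter X _ _ HV (H W HW)).
  intros p. specialize (HVU p). tauto.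
Qed.

Lemma continuous_on_Union {I : Type} (N : I -> X -> Prop) f :
  (forall i, continuous_on O (N i) f) -> continuous_on O (fun p => exists i, N i p) f.
Proof.
  intros H V HV. apply open_eq with (2 := open_Union _ (fun i => H i V HV)).
  intros p. split; [intros [i [H1 H2]]; eauto|intros [[i H1] H2]; eauto].
Qed.

Lemma continuous_on_or U V f : continuous_on O U f -> continuous_on O V f ->
  continuous_on O (fun p => U p \/ V p) f.
Proof.
  intros HU HV W HW. apply open_eq with (2 := open_or _ _ (HU W HW) (HV W HW)). intros p. tauto.
Qed.

End Topology.

(** * Extension over unions of clopen sets *)

Lemma type_lt_indexed (K : Type) (X : TopSpace) {I : Type} (N : I -> X -> Prop) :
  (forall i, clopen X (N i)) -> lt_card I K -> type_lt K X (fun p => exists i, N i p).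
Proof.
  intros HN HI. exists (fun V => exists i, N i = V). split; [|split].
  - intros V [i <-]. apply HN.
  - eapply le_lt_card; [apply le_card_image|exact HI].
  - intros p. split; [intros [i Hp]; eauto|intros [V [[i <-] Hp]]; eauto].
Qed.

Lemma type_lt_or (K : Type) (X : TopSpace) (U V : X -> Prop) : kappa_eq_kappa_lt K ->
  type_lt K X U -> type_lt K X V -> type_lt K X (fun p => U p \/ V p).
Proof.
  intros HK [F [HF [CF EF]]] [G [HG [CG EG]]].
  replace (fun p => U p \/ V p) with
    (fun p => exists i : {V | F V} + {V | G V},
       match i with inl a => proj1_sig a | inr a => proj1_sig a end p).
  - apply type_lt_indexed; [|apply kappa_sum; assumption].
    intros [[W HW]|[W HW]]; auto.
  - apply pred_ext. intros p. rewrite EF, EG. split.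
    + intros [[[W HW]|[W HW]] Hp]; eauto.
    + intros [[W [HW Hp]]|[W [HW Hp]]].
      * exists (inl (exist _ W HW)). exact Hp.
      * exists (inr (exist _ W HW)). exact Hp.
Qed.

Lemma continuous_on_comp {X : TopSpace} {T T' : Type} (O : (T -> Prop) -> Prop)
  (O' : (T' -> Prop) -> Prop) (U : X -> Prop) (f : X -> T) (h : T -> T') :
  (forall Q, O' Q -> O (fun t => Q (h t))) -> continuous_on O U f ->
  continuous_on O' U (fun p => h (f p)).
Proof. intros H Hf Q HQ. exact (Hf _ (H Q HQ)). Qed.

Definition discrete {T : Type} (Q : T -> Prop) : Prop := True.

Lemma continuous_on_bool {X : TopSpace} (U : X -> Prop) (f : X -> bool) :
  is_open (fun p => U p /\ f p = true) -> is_open (fun p => U p /\ f p = false) ->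
  continuous_on discrete U f.
Proof.
  intros H1 H2 Q _.
  apply open_eq with (fun p => (U p /\ f p = true) /\ Q true \/ (U p /\ f p = false) /\ Q false).
  - intros p. destruct (f p); intuition congruence.
  - apply open_or; apply open_inter; auto using open_const.
Qed.

Definition indicator {X : Type} (A : X -> Prop) (p : X) : bool :=
  if excluded_middle_informative (A p) then true else false.

Lemma indicator_true {X : Type} (A : X -> Prop) p : indicator A p = true <-> A p.
Proof.
  unfold indicator. destruct (excluded_middle_informative (A p)); intuition congruence.
Qed.

Lemma indicator_false {X : Type} (A : X -> Prop) p : indicator A p = false <-> ~ A p.
Proof.
  unfold indicator. destruct (excluded_middle_informative (A p)); intuition congruence.
Qed.

(** Isolates what the recursion over a cover needs of its target, so that it serves real and
    two-valued functions alike. The predicate [Bd] carries one bound through every stage, which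
    keeps the glued real function bounded. *)
Definition extension_property (K : Type) (X : TopSpace) {T : Type} (O : (T -> Prop) -> Prop)
  (Bd : T -> Prop) : Prop :=
  forall (U : X -> Prop) (f : X -> T), is_open U -> type_lt K X U ->
    continuous_on O U f -> (forall p, U p -> Bd (f p)) ->
    exists g, continuous_on O (fun _ => True) g /\ (forall p, U p -> g p = f p) /\
      forall p, Bd (g p).

Definition clamp (M t : R) : R := Rmax (- M) (Rmin M t).

Lemma clamp_bound M t : 0 <= M -> Rabs (clamp M t) <= M.
Proof.
  intros HM. unfold clamp, Rmax, Rmin.
  repeat destruct Rle_dec; apply Rabs_le; lra.
Qed.

Lemma clamp_id M t : Rabs t <= M -> clamp M t = t.
Proof.
  intros H. assert (H1 := Rle_abs t). assert (H2 := Rle_abs (- t)). rewrite Rabs_Ropp in H2.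
  unfold clamp, Rmax, Rmin.
  repeat destruct Rle_dec; lra.
Qed.

Lemma clamp_open M Q : R_open Q -> R_open (fun t => Q (clamp M t)).
Proof.
  intros HQ t Ht. destruct (HQ _ Ht) as [e [He H]]. exists e. split; [exact He|].
  intros s Hs. apply H. eapply Rle_lt_trans; [|exact Hs].
  unfold clamp, Rmax, Rmin, Rabs.
  repeat destruct Rle_dec; repeat destruct Rcase_abs; lra.
Qed.

Lemma real_extension (K : Type) (X : TopSpace) (M : R) : F_kappa_space K X -> 0 <= M ->
  extension_property K X R_open (fun t => Rabs t <= M).
Proof.
  intros [_ HF] HM U f HU HT Hf Hb.
  destruct (HF U HU HT (fun y => f (proj1_sig y))) as [g [Hg Eg]].
  - intros Q HQ. exists (fun p => U p /\ Q (f p)). split; [apply Hf, HQ|].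
    intros [y Hy]. simpl. tauto.
  - exists M. intros [y Hy]. apply Hb, Hy.
  - exists (fun p => clamp M (g p)). split; [|split].
    + intros Q HQ. apply open_eq with (2 := Hg _ (clamp_open M Q HQ)). tauto.
    + intros p Hp. rewrite <- (clamp_id M (f p)) by auto. f_equal.
      exact (Eg (exist _ p Hp)).
    + intros p. apply clamp_bound, HM.
Qed.

Lemma R_open_gt a : R_open (fun t => a < t).
Proof.
  intros t Ht. exists (t - a). split; [lra|]. intros s Hs. apply Rabs_def2 in Hs. lra.
Qed.

Lemma R_open_lt a : R_open (fun t => t < a).
Proof.
  intros t Ht. exists (a - t). split; [lra|]. intros s Hs. apply Rabs_def2 in Hs. lra.
Qed.

(** The function is extended as a real function [g] with values 0 and 1 on [U]; a clopen set
    squeezed between the closed set 2/3 <= g and the open set 1/3 < g rounds [g] back to two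
    values. *)
Lemma bool_extension (K : Type) (X : TopSpace) : compact X -> F_kappa_space K X ->
  extension_property K X discrete (fun _ : bool => True).
Proof.
  intros HX HF U f HU HT Hf _.
  destruct (real_extension K X 1 HF Rle_0_1 U (fun p => if f p then 1 else 0) HU HT)
    as [g [Hg [Eg _]]].
  - apply (continuous_on_comp discrete R_open U f (fun b : bool => if b then 1 else 0));
      [intros Q _; exact I|exact Hf].
  - intros p _. destruct (f p); [rewrite Rabs_R1|rewrite Rabs_R0]; lra.
  - destruct (clopen_between (fun p => 2/3 <= g p) (fun p => 1/3 < g p) HX (proj1 HF))
      as [E [HE [E1 E2]]].
    + apply open_eq with (2 := Hg _ (R_open_lt (2/3))). intros p. split; [lra|].
      intros H. split; [exact I|lra].
    + apply open_eq with (2 := Hg _ (R_open_gt (1/3))). tauto.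
    + intros p Hp. lra.
    + exists (indicator E). split; [|split; [|auto]].
      * apply continuous_on_bool.
        -- apply open_eq with (2 := proj1 HE). intros p. rewrite indicator_true. tauto.
        -- apply open_eq with (2 := proj2 HE). intros p. rewrite indicator_false. tauto.
      * intros p Hp. specialize (Eg p Hp). specialize (E1 p). specialize (E2 p).
        destruct (f p).
        -- apply indicator_true, E1. lra.
        -- apply indicator_false. intros H. apply E2 in H. lra.
Qed.

(* The extension is built along the well-order: at stage [k] only the part of the domain lying in
   [C k] together with the traces of the earlier [C j], a set of type < K, has to be respected. *)
Lemma extend_over_cover (K : Type) (lt : K -> K -> Prop) (X : TopSpace) {T : Type}
  (O : (T -> Prop) -> Prop) (Bd : T -> Prop) (C : K -> X -> Prop) (P : X -> Prop) (f0 : X -> T) :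
  kappa_eq_kappa_lt K -> well_ordered lt -> (forall k, lt_card {j | lt j k} K) ->
  extension_property K X O Bd -> (forall k, clopen X (C k)) ->
  is_open P -> (forall k, type_lt K X (fun p => P p /\ C k p)) ->
  continuous_on O P f0 -> (forall p, P p -> Bd (f0 p)) ->
  exists f, continuous_on O (fun p => exists k, C k p) f /\
    (forall p, (exists k, C k p) -> P p -> f p = f0 p) /\
    (forall p, (exists k, C k p) -> Bd (f p)).
Proof.
  intros HK [W [Tr T3]] Sm Ext HC HP HT Hf0 HB.
  set (Rk := fun k (h : K -> X -> T) (a : X -> T) =>
    continuous_on O (C k) a /\ (forall p, C k p -> Bd (a p)) /\
    (forall p, C k p -> P p -> a p = f0 p) /\
    forall j, lt j k -> forall p, C j p -> C k p -> a p = h j p).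
  (* By trichotomy any two stages agree where they overlap, so those already built glue to one
     function, which also agrees with [f0] on the covered part of [P]. *)
  assert (Glue : forall (D : K -> Prop) (h : K -> X -> T), (forall j, D j -> Rk j h (h j)) ->
    exists f : X -> T, forall p, (P p -> (exists k, C k p) -> f p = f0 p) /\
      forall j, D j -> C j p -> f p = h j p).
  { intros D h Hh.
    apply (choice_fun (fun p t => (P p -> (exists k, C k p) -> t = f0 p) /\
      forall j, D j -> C j p -> t = h j p)). intros p.
    destruct (classic (exists j, D j /\ C j p)) as [[j [Dj Cj]]|N].
    - exists (h j p). split.
      + intros Pp _. apply (Hh j Dj); assumption.
      + intros i Di Ci. destruct (T3 i j) as [L|[-> |L]]; [|reflexivity|].
        * apply (Hh j Dj); assumption.
        * symmetry. apply (Hh i Di); assumption.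
    - exists (f0 p). split; [auto|]. intros j Dj Cj. exfalso. eauto. }
  destruct (wf_choice lt Rk W) as [h Hh].
  - exact (inhabits f0).
  - intros k h h' a E (H1 & H2 & H3 & H4). split; [exact H1|split; [exact H2|split; [exact H3|]]].
    intros j Hj p Cj Ck. rewrite <- E by exact Hj. auto.
  - intros k h IH. destruct (Glue (fun j => lt j k) h IH) as [f Hf].
    set (V := fun p => (P p /\ C k p) \/ exists i : {j | lt j k}, C (proj1_sig i) p /\ C k p).
    destruct (Ext V f) as [g [Hg [Eg Bg]]].
    + apply open_or; [apply open_inter; [exact HP|apply HC]|].
      apply open_Union. intros i. apply open_inter; apply HC.
    + apply type_lt_or; [exact HK|apply HT|]. apply type_lt_indexed; [|apply Sm].
      intros i. apply clopen_and; apply HC.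
    + apply continuous_on_or.
      * apply continuous_on_eq with f0.
        { intros p [Pp Cp]. symmetry. apply Hf; eauto. }
        apply continuous_on_sub with (3 := Hf0); [|tauto].
        apply open_inter; [exact HP|apply HC].
      * apply continuous_on_Union. intros [j Hj]. simpl.
        apply continuous_on_eq with (h j).
        { intros p [Cj Cp]. symmetry. apply Hf; eauto. }
        apply continuous_on_sub with (3 := proj1 (IH j Hj)); [|tauto].
        apply open_inter; apply HC.
    + intros p [[Pp Cp]|[[j Hj] [Cj Cp]]]; simpl in *.
      * replace (f p) with (f0 p); [auto|symmetry; apply Hf; eauto].
      * replace (f p) with (h j p); [apply (IH j Hj), Cj|symmetry; apply Hf; eauto].
    + exists g. split; [|split; [|split]].
      * apply continuous_on_sub with (3 := Hg); [apply HC|auto].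
      * auto.
      * intros p Cp Pp. rewrite Eg by (left; auto). apply Hf; eauto.
      * intros j Hj p Cj Cp. rewrite Eg; [apply Hf; auto|].
        right. exists (exist _ j Hj). auto.
  - destruct (Glue (fun _ => True) h (fun j _ => Hh j)) as [f Hf].
    exists f. split; [|split].
    + apply continuous_on_Union. intros k. apply continuous_on_eq with (h k).
      * intros p Cp. symmetry. apply Hf; auto.
      * apply Hh.
    + intros p Cp Pp. apply Hf; assumption.
    + intros p [k Cp]. replace (f p) with (h k p); [apply Hh, Cp|symmetry; apply Hf; auto].
Qed.

(** * The compactification of the punctured space *)

Section Remainder.
Context (K : Type) (lt : K -> K -> Prop) (S : TopSpace) (x : S) (Y : TopSpace).
Context (e : subspace S (fun y => y <> x) -> Y).
Hypothesis kappaK : kappa_eq_kappa_lt K.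
Hypothesis lt_wo : well_ordered lt.
Hypothesis lt_small : forall k, lt_card {j | lt j k} K.
Hypothesis S_parovicenko : kappa_Parovicenko K S.
Hypothesis e_stone_cech : is_stone_cech (subspace S (fun y => y <> x)) Y e.
Context (C : K -> S -> Prop).
Hypothesis C_clopen : forall k, clopen S (C k).
Hypothesis C_cover : forall p, (exists k, C k p) <-> p <> x.

Let S_compact : compact S := proj1 S_parovicenko.
Let S_hausdorff : hausdorff S := proj1 (proj2 S_parovicenko).
Let S_zero : zero_dimensional S := proj1 (proj2 (proj2 S_parovicenko)).
Let S_F : F_kappa_space K S := proj1 (proj2 (proj2 (proj2 S_parovicenko))).
Let S_G : G_kappa_space K S := proj1 (proj2 (proj2 (proj2 (proj2 S_parovicenko)))).
Let S_perfect : no_isolated_points S := proj2 (proj2 (proj2 (proj2 (proj2 S_parovicenko)))).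
Let Y_compact : compact Y := proj1 e_stone_cech.
Let Y_hausdorff : hausdorff Y := proj1 (proj2 e_stone_cech).

(* The intersection of [W] with the punctured space, seen inside [S]. *)
Definition trace (W : Y -> Prop) (p : S) : Prop := exists h : p <> x, W (e (exist _ p h)).

Lemma trace_at (W : Y -> Prop) p (h : p <> x) : trace W p <-> W (e (exist _ p h)).
Proof.
  split; [intros [h' H]|intros H; exists h; exact H].
  rewrite (proof_irrelevance _ h h'). exact H.
Qed.

Lemma trace_not (W : Y -> Prop) p : trace (fun y => ~ W y) p <-> p <> x /\ ~ trace W p.
Proof.
  split.
  - intros [h H]. split; [exact h|]. rewrite (trace_at W p h). exact H.
  - intros [h H]. exists h. rewrite <- trace_at. exact H.
Qed.

Lemma punctured_open : is_open (fun p => p <> x).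
Proof. apply hausdorff_closed_point, S_hausdorff. Qed.

Lemma trace_open (W : Y -> Prop) : is_open W -> is_open (trace W).
Proof.
  intros HW. assert (Hc := proj1 (proj1 (proj2 (proj2 e_stone_cech)))).
  destruct (Hc W HW) as [U [HU EU]].
  apply open_eq with (2 := open_inter S _ _ punctured_open HU). intros p. split.
  - intros [h Up]. exists h. apply EU. exact Up.
  - intros [h Wp]. split; [exact h|]. apply EU in Wp. exact Wp.
Qed.

Lemma open_trace (U : S -> Prop) : is_open U -> (forall p, U p -> p <> x) ->
  exists V, is_open V /\ forall p, U p <-> trace V p.
Proof.
  intros HU Ux. assert (He := proj2 (proj2 (proj1 (proj2 (proj2 e_stone_cech))))).
  destruct (He (fun y => U (proj1_sig y))) as [V [HV EV]].
  - exists U. split; [exact HU|tauto].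
  - exists V. split; [exact HV|]. intros p. split.
    + intros Up. exists (Ux p Up). apply EV. exact Up.
    + intros [h Vp]. apply EV in Vp. exact Vp.
Qed.

Lemma trace_dense (V : Y -> Prop) y : is_open V -> V y -> exists p, trace V p.
Proof.
  intros HV Hy. assert (Hd := proj1 (proj2 (proj2 (proj2 e_stone_cech)))).
  destruct (Hd V HV (ex_intro _ y Hy)) as [[p h] Hp]. exists p, h. exact Hp.
Qed.

(** If [V] were not inside [Z], the open set [V] minus [Z] would meet the dense punctured space.
    This carries statements about traces back to [Y]. *)
Lemma trace_closed_sub (V Z : Y -> Prop) : is_open V -> is_open (fun y => ~ Z y) ->
  (forall p, trace V p -> trace Z p) -> forall y, V y -> Z y.
Proof.
  intros HV HZ Sub y Vy. apply NNPP. intros N.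
  destruct (trace_dense (fun y => V y /\ ~ Z y) y) as [p [h [H1 H2]]]; auto using open_inter.
  apply H2, trace_at, Sub. exists h. exact H1.
Qed.

(** * Clopen sets of the compactification from functions on the punctured space *)

Lemma stone_cech_real (f : S -> R) (M : R) :
  continuous_on R_open (fun p => p <> x) f -> (forall p, p <> x -> Rabs (f p) <= M) ->
  exists g : Y -> R, continuous_R Y g /\ forall p (h : p <> x), g (e (exist _ p h)) = f p.
Proof.
  intros Hf Hb. assert (He := proj2 (proj2 (proj2 (proj2 e_stone_cech)))).
  destruct (He (fun y => f (proj1_sig y))) as [g [Hg Eg]].
  - intros Q HQ. exists (fun p => p <> x /\ Q (f p)). split; [apply Hf, HQ|].
    intros [p h]. simpl. tauto.
  - exists M. intros [p h]. apply Hb, h.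
  - exists g. split; [exact Hg|]. intros p h. apply Eg.
Qed.

Lemma stone_cech_clopen (f : S -> bool) : continuous_on discrete (fun p => p <> x) f ->
  exists V, clopen Y V /\ forall p, p <> x -> (trace V p <-> f p = true).
Proof.
  intros Hf.
  destruct (stone_cech_real (fun p => if f p then 1 else 0) 1) as [g [Hg Eg]].
  - apply (continuous_on_comp discrete R_open _ f (fun b : bool => if b then 1 else 0));
      [intros Q _; exact I|exact Hf].
  - intros p _. destruct (f p); [rewrite Rabs_R1|rewrite Rabs_R0]; lra.
  - assert (V1 := Hg _ (R_open_gt (1/2))). assert (V2 := Hg _ (R_open_lt (1/2))).
    (* The extension never takes the value 1/2: the open set where it lies between 1/4 and 3/4
       contains no point of the punctured space, hence is empty by density. *)
    assert (D : forall y, ~ g y = 1/2).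
    { intros y Ey.
      destruct (trace_dense (fun z => 1/4 < g z /\ g z < 3/4) y) as [p [h Hp]].
      - exact (open_inter Y _ _ (Hg _ (R_open_gt (1/4))) (Hg _ (R_open_lt (3/4)))).
      - lra.
      - rewrite Eg in Hp. destruct (f p); lra. }
    exists (fun y => 1/2 < g y). split; [split; [exact V1|]|].
    + apply open_eq with (2 := V2). intros y. specialize (D y). split; [lra|].
      intros H. destruct (Rtotal_order (g y) (1/2)) as [L|[L|L]]; tauto.
    + intros p h. rewrite (trace_at _ p h), Eg. destruct (f p); split; intros; try discriminate; lra.
Qed.

(** Source of clopen sets of [Y] both for separating points and for the weight: the partial function
    is extended first over the whole punctured space, then over [Y]. *)
Lemma clopen_extension (P : S -> Prop) (f : S -> bool) : is_open P ->
  (forall k, type_lt K S (fun p => P p /\ C k p)) -> continuous_on discrete P f ->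
  exists V, clopen Y V /\ forall p, p <> x -> P p -> (trace V p <-> f p = true).
Proof.
  intros HP HT Hf.
  destruct (extend_over_cover K lt S discrete (fun _ => True) C P f) as [g [Hg [Eg _]]]; auto.
  { apply bool_extension; [exact S_compact|exact S_F]. }
  rewrite (pred_ext _ _ C_cover) in Hg. destruct (stone_cech_clopen g Hg) as [V [HV EV]].
  exists V. split; [exact HV|]. intros p h Pp. rewrite EV, Eg; [tauto| |exact Pp|exact h].
  apply C_cover, h.
Qed.

Lemma stone_cech_no_isolated : no_isolated_points Y.
Proof.
  (* By density an isolated point would lie in the punctured space, and it would be isolated in [S]
     because that space is open there. *)
  intros y Hy. destruct (trace_dense _ y Hy eq_refl) as [p [h Hp]].
  apply (S_perfect p). apply open_eq with (2 := trace_open _ Hy). intros q. split.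
  - intros [h' Hq]. assert (Inj := proj1 (proj2 (proj1 (proj2 (proj2 e_stone_cech))))).
    assert (E := Inj _ _ (eq_trans Hq (eq_sym Hp))). exact (f_equal (@proj1_sig _ _) E).
  - intros ->. exists h. exact Hp.
Qed.

(** * Zero-dimensionality *)

Lemma closed_trace (A : Y -> Prop) k : is_open (fun y => ~ A y) ->
  is_open (fun p => ~ (trace A p /\ C k p)).
Proof.
  (* As [C k] is clopen and misses [x], the trace of a closed set on it is closed in all of [S], not
     only in the punctured space. *)
  intros HA. apply open_eq with (2 := open_or _ _ (trace_open _ HA) (proj2 (C_clopen k))).
  intros p. rewrite trace_not.
  assert (H : C k p -> p <> x) by (intros H; apply C_cover; eauto). tauto.
Qed.

(** Inside [C k], a clopen set fits between the trace of [A n] and that of [G n]; since [G n] lies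
    in [A (n + 1)], these countably many clopen sets exhaust the union. *)
Lemma sigma_trace_type (A G : nat -> Y -> Prop) k : lt_card nat K ->
  (forall n, is_open (fun y => ~ A n y)) -> (forall n, is_open (G n)) ->
  (forall n y, A n y -> G n y) -> (forall n y, G n y -> A (n + 1)%nat y) ->
  type_lt K S (fun p => trace (fun y => exists n, G n y) p /\ C k p).
Proof.
  intros HN HA HG AG GA.
  destruct (choice_fun (fun n E => clopen S E /\ (forall p, trace (A n) p /\ C k p -> E p) /\
    forall p, E p -> trace (G n) p /\ C k p)) as [E HE].
  - intros n. apply clopen_between; auto.
    + apply closed_trace, HA.
    + apply open_inter; [apply trace_open, HG|apply C_clopen].
    + intros p [[h Ap] Cp]. split; [exists h; auto|exact Cp].
  - replace (fun p => trace (fun y => exists n, G n y) p /\ C k p) with (fun p => exists n, E n p).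
    + apply type_lt_indexed; [|exact HN]. intros n. apply HE.
    + apply pred_ext. intros p. split.
      * intros [n En]. apply HE in En. destruct En as [[h Gp] Cp].
        split; [exists h; eauto|exact Cp].
      * intros [[h [n Gp]] Cp]. exists (n + 1)%nat. apply HE. split; [exists h; auto|exact Cp].
Qed.

(* Alternating closed and open sets around two disjoint closed sets produce disjoint open sets
   that are F_sigma; inside each [C k] these have countable type. *)
Lemma uncountable_separation (y y' : Y) : lt_card nat K -> y <> y' ->
  exists V, clopen Y V /\ V y /\ ~ V y'.
Proof.
  intros HN Hy.
  (* A state is a pair of disjoint closed sets; [link] records the pair of open sets inserted
     between two successive states. *)
  set (good := fun s : (Y -> Prop) * (Y -> Prop) => is_open (fun q => ~ fst s q) /\
    is_open (fun q => ~ snd s q) /\ forall q, ~ (fst s q /\ snd s q)).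
  set (link := fun s (r : ((Y -> Prop) * (Y -> Prop)) * ((Y -> Prop) * (Y -> Prop))) =>
    good (snd r) /\ is_open (fst (fst r)) /\ is_open (snd (fst r)) /\
    (forall q, fst s q -> fst (fst r) q) /\ (forall q, fst (fst r) q -> fst (snd r) q) /\
    (forall q, snd s q -> snd (fst r) q) /\ (forall q, snd (fst r) q -> snd (snd r) q)).
  destruct (choice_fun (fun s r => good s -> link s r)) as [step Hstep].
  { intros s. destruct (classic (good s)) as [[H1 [H2 H3]]|N].
    - destruct (normal_step (fst s) (snd s))
        as (G & H & A & B & J1 & J2 & J3 & J4 & J5 & J6 & J7 & J8 & J9); auto.
      exists ((G, H), (A, B)). intros _. unfold link, good. simpl. tauto.
    - exists (s, s). tauto. }
  set (st := fun n => Nat.iter n (fun s => snd (step s)) (fun q => q = y, fun q => q = y')).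
  assert (Gd : forall n, good (st n)).
  { induction n as [|n IH]; [|apply (Hstep (st n) IH)].
    split; [|split].
    - apply hausdorff_closed_point, Y_hausdorff.
    - apply hausdorff_closed_point, Y_hausdorff.
    - simpl. intros q [-> E]. exact (Hy E). }
  assert (Lk : forall n, link (st n) (step (st n))) by (intros n; apply Hstep, Gd).
  assert (StS : forall n, st (n + 1)%nat = snd (step (st n))).
  { intros n. rewrite Nat.add_1_r. reflexivity. }
  set (G := fun n => fst (fst (step (st n)))). set (H := fun n => snd (fst (step (st n)))).
  assert (AG : forall n q, fst (st n) q -> G n q) by (intros n; apply (Lk n)).
  assert (BH : forall n q, snd (st n) q -> H n q) by (intros n; apply (Lk n)).
  assert (GA : forall n q, G n q -> fst (st (n + 1)%nat) q)
    by (intros n; rewrite StS; apply (Lk n)).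
  assert (HB : forall n q, H n q -> snd (st (n + 1)%nat) q)
    by (intros n; rewrite StS; apply (Lk n)).
  assert (GO : forall n, is_open (G n)) by (intros n; apply (Lk n)).
  assert (HO : forall n, is_open (H n)) by (intros n; apply (Lk n)).
  assert (MA : forall n m q, fst (st n) q -> fst (st (m + n)%nat) q).
  { intros n m q Hq. induction m as [|m IH]; [exact Hq|].
    replace (Datatypes.S m + n)%nat with (m + n + 1)%nat by lia. apply GA, AG, IH. }
  assert (MB : forall n m q, snd (st n) q -> snd (st (m + n)%nat) q).
  { intros n m q Hq. induction m as [|m IH]; [exact Hq|].
    replace (Datatypes.S m + n)%nat with (m + n + 1)%nat by lia. apply HB, BH, IH. }
  (* Membership in [G n] and in [H m] persists to the closed sets of stage n + m + 2, which are
     disjoint. *)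
  assert (D : forall n m q, G n q -> H m q -> False).
  { intros n m q Gq Hq. apply GA, (MA _ (m + 1)%nat) in Gq. apply HB, (MB _ (n + 1)%nat) in Hq.
    rewrite (Nat.add_comm (m + 1)) in Gq. apply (proj2 (proj2 (Gd _)) q (conj Gq Hq)). }
  set (GU := fun q => exists n, G n q). set (HU := fun q => exists n, H n q).
  assert (GUO : is_open GU) by (apply open_Union; exact GO).
  assert (HUO : is_open HU) by (apply open_Union; exact HO).
  destruct (clopen_extension (fun p => trace GU p \/ trace HU p) (indicator (trace GU)))
    as [V [HV EV]].
  - apply open_or; apply trace_open; assumption.
  - intros k.
    replace (fun p => (trace GU p \/ trace HU p) /\ C k p)
      with (fun p => (trace GU p /\ C k p) \/ (trace HU p /\ C k p))
      by (apply pred_ext; tauto).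
    apply type_lt_or; [exact kappaK| |].
    + apply sigma_trace_type with (A := fun n => fst (st n)); auto. intros n. apply (Gd n).
    + apply sigma_trace_type with (A := fun n => snd (st n)); auto. intros n. apply (Gd n).
  - apply continuous_on_bool.
    + apply open_eq with (2 := trace_open _ GUO). intros p. rewrite indicator_true. tauto.
    + apply open_eq with (2 := trace_open _ HUO). intros p. rewrite indicator_false.
      split; [|tauto]. intros Hp. split; [tauto|]. intros [h [n Gn]].
      destruct Hp as [h' [m Hm]]. rewrite (proof_irrelevance _ h h') in Gn. eauto.
  - exists V. split; [exact HV|split].
    (* The point [y] may lie outside the punctured space, but it is in the open set [GU], which is
       inside [V] by density. *)
    + apply (trace_closed_sub GU V); [exact GUO|apply HV| |].
      * intros p Gp. assert (h : p <> x) by (destruct Gp; assumption).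
        apply EV; [exact h|auto|]. apply indicator_true, Gp.
      * exists 0%nat. apply AG. reflexivity.
    + apply (trace_closed_sub HU (fun q => ~ V q)); [exact HUO|apply clopen_compl, HV| |].
      * intros p Hp. assert (h : p <> x) by (destruct Hp; assumption).
        apply trace_not. split; [exact h|]. rewrite EV; [|exact h|auto].
        rewrite indicator_true. intros [h1 [n Gn]]. destruct Hp as [h2 [m Hm]].
        rewrite (proof_irrelevance _ h1 h2) in Gn. eauto.
      * exists 0%nat. apply BH. reflexivity.
Qed.

(** For countable [K] a countable union need not have type below [K]. Instead each [C k] is cut down
    to a clopen [L k] by removing the finitely many earlier ones. The [L k] are disjoint, so clopen
    sets [E k] separating the traces can be chosen independently on the pieces and still define a
    continuous function. *)
Lemma countable_separation (y y' : Y) : le_card K nat -> y <> y' ->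
  exists V, clopen Y V /\ V y /\ ~ V y'.
Proof.
  intros [i Hi] Hy.
  (* Neighbourhoods are separated rather than points, since [y] and [y'] may lie outside the
     punctured space. *)
  destruct (normal_step (fun q => q = y) (fun q => q = y'))
    as (G & H & A & B & GO & HO & AC & BC & yG & GA & y'H & HB & D); auto.
  { apply hausdorff_closed_point, Y_hausdorff. }
  { apply hausdorff_closed_point, Y_hausdorff. }
  { intros q [-> E]. exact (Hy E). }
  destruct (choice_fun (fun k E => clopen S E /\ (forall p, trace A p /\ C k p -> E p) /\
    forall p, E p -> ~ (trace B p /\ C k p))) as [E HE].
  { intros k. apply clopen_between; auto.
    - apply closed_trace, AC.
    - apply closed_trace, BC.
    - intros p [[h Ap] _] [[h' Bp] _]. rewrite (proof_irrelevance _ h h') in Ap.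
      apply (D _ (conj Ap Bp)). }
  set (L := fun k p => C k p /\ forall j, (i j < i k)%nat -> ~ C j p).
  assert (LC : forall k, clopen S (L k)).
  { intros k. apply clopen_and; [apply C_clopen|].
    assert (Fin : forall n, exists l, forall j, In j l <-> (i j < n)%nat).
    { induction n as [|n [l Hl]]; [exists nil; intros j; simpl; lia|].
      destruct (classic (exists m, i m = n)) as [[m Hm]|N].
      - exists (m :: l). intros j. simpl. rewrite Hl. split.
        + intros [<- |J]; lia.
        + intros J. destruct (Nat.eq_dec (i j) n) as [Ej|Ej]; [left; apply Hi; congruence|lia].
      - exists l. intros j. rewrite Hl. split; [lia|]. intros J.
        assert (i j <> n) by eauto. lia. }
    destruct (Fin (i k)) as [l Hl].
    replace (fun p => forall j, (i j < i k)%nat -> ~ C j p)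
      with (fun p => ~ exists j, In j l /\ C j p).
    - apply clopen_compl, clopen_list_or. auto.
    - apply pred_ext. intros p. split.
      + intros N j J Cj. apply N. exists j. rewrite Hl. auto.
      + intros N [j [J Cj]]. apply Hl in J. exact (N j J Cj). }
  assert (LU : forall p k k', L k p -> L k' p -> k = k').
  { intros p k k' [H1 H2] [H3 H4]. apply Hi.
    destruct (Nat.lt_total (i k) (i k')) as [T|[T|T]]; [|exact T|].
    - exfalso. exact (H4 k T H1).
    - exfalso. exact (H2 k' T H3). }
  assert (LX : forall p, p <> x -> exists k, L k p).
  { intros p Hp. apply C_cover in Hp.
    destruct (wf_min _ (wf_inverse_image _ _ _ i Nat.lt_wf_0) _ Hp) as [k [Hk Mk]].
    exists k. split; [exact Hk|exact Mk]. }
  assert (Lx : forall p k, L k p -> p <> x).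
  { intros p k Lk. apply C_cover. exists k. apply Lk. }
  destruct (stone_cech_clopen (indicator (fun p => exists k, L k p /\ E k p))) as [V [HV EV]].
  - apply continuous_on_bool.
    + apply open_eq with (fun p => exists k, L k p /\ E k p).
      * intros p. rewrite indicator_true. split; [|tauto]. intros [k [Lk Ek]]. eauto.
      * apply open_Union. intros k. apply open_inter; [apply LC|apply HE].
    + apply open_eq with (fun p => exists k, L k p /\ ~ E k p).
      * intros p. rewrite indicator_false. split.
        -- intros [k [Lk Nk]]. split; [eauto|]. intros [k' [Lk' Ek']].
           rewrite (LU p k k' Lk Lk') in Nk. auto.
        -- intros [h N]. destruct (LX p h) as [k Lk]. exists k. split; [exact Lk|]. eauto.
      * apply open_Union. intros k. apply open_inter; [apply LC|apply HE].
  - exists V. split; [exact HV|split].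
    + apply (trace_closed_sub G V); [exact GO|apply HV| |auto].
      intros p [h Gp]. apply EV; [exact h|]. apply indicator_true.
      destruct (LX p h) as [k Lk]. exists k. split; [exact Lk|].
      apply HE. split; [exists h; auto|apply Lk].
    + apply (trace_closed_sub H (fun q => ~ V q)); [exact HO|apply clopen_compl, HV| |auto].
      intros p [h Hp]. apply trace_not. split; [exact h|]. rewrite EV by exact h.
      rewrite indicator_true. intros [k [Lk Ek]]. apply (HE k) in Ek. apply Ek.
      split; [exists h; auto|apply Lk].
Qed.

Lemma stone_cech_zero_dimensional : zero_dimensional Y.
Proof.
  apply clopen_separation_zero_dimensional; [exact Y_compact|]. intros y y' Hy.
  destruct (classic (le_card K nat)) as [Hc|Hc].
  - apply countable_separation; assumption.
  - apply uncountable_separation; [split; [apply kappaK|exact Hc]|exact Hy].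
Qed.

(** * The F_kappa-property *)

Lemma stone_cech_F_kappa : F_kappa_space K Y.
Proof.
  split; [exact stone_cech_zero_dimensional|].
  intros W HW [F [HF [CF EF]]] f Hf [M HM].
  destruct (choice_fun (fun p t => forall (h : p <> x) (w : W (e (exist _ p h))),
    t = f (exist _ _ w))) as [f0 Hf0].
  { intros p. destruct (classic (trace W p)) as [[h w]|N].
    - exists (f (exist _ _ w)). intros h'. rewrite <- (proof_irrelevance _ h h').
      intros w'. rewrite (proof_irrelevance _ w w'). reflexivity.
    - exists 0. intros h w. exfalso. apply N. exists h. exact w. }
  (* [Rabs M] replaces [M], which may be negative when [W] is empty. *)
  destruct (extend_over_cover K lt S R_open (fun t => Rabs t <= Rabs M) C (trace W) f0)
    as [g [Hg [Eg Bg]]]; auto.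
  - apply real_extension; [exact S_F|apply Rabs_pos].
  - apply trace_open, HW.
  - intros k.
    (* Each clopen set in the union has a clopen trace on [C k], so the trace of [W] there has type
       below [K]. *)
    replace (fun p => trace W p /\ C k p)
      with (fun p => exists V : {V | F V}, trace (proj1_sig V) p /\ C k p).
    + apply type_lt_indexed; [|exact CF]. intros [V HV]. simpl. split.
      * apply open_inter; [apply trace_open, HF, HV|apply C_clopen].
      * apply closed_trace, HF, HV.
    + apply pred_ext. intros p. split.
      * intros [[V HV] [[h Vp] Cp]]. split; [|exact Cp]. exists h. apply EF. eauto.
      * intros [[h Wp] Cp]. apply EF in Wp. destruct Wp as [V [HV Vp]].
        exists (exist _ V HV). split; [exists h; exact Vp|exact Cp].
  - intros Q HQ. destruct (Hf Q HQ) as [U [HU EU]].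
    apply open_eq with (2 := trace_open _ (open_inter Y _ _ HW HU)). intros p. split.
    + intros [h [Wp Up]]. split; [exists h; exact Wp|]. rewrite (Hf0 p h Wp). apply EU, Up.
    + intros [[h Wp] Qp]. exists h. split; [exact Wp|]. rewrite (Hf0 p h Wp) in Qp.
      apply EU in Qp. exact Qp.
  - intros p [h Wp]. rewrite (Hf0 p h Wp).
    eapply Rle_trans; [apply HM|apply Rle_abs].
  - rewrite (pred_ext _ _ C_cover) in Hg.
    destruct (stone_cech_real g (Rabs M) Hg) as [G [HG EG]].
    { intros p h. apply Bg, C_cover, h. }
    exists G. split; [exact HG|]. intros [y Wy]. simpl.
    (* Both functions are continuous on [W] and agree on its trace. If they differed by [d] at [y],
       density would give a point of the trace where each is within d/2 of its value at [y], a
       contradiction. *)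
    apply NNPP. intros N. set (v := f (exist _ y Wy)) in *.
    set (d := Rabs (G y - v)).
    assert (Hd : 0 < d) by (apply Rabs_pos_lt; lra).
    assert (Ball : forall c, R_open (fun t => Rabs (t - c) < d / 2)).
    { intros c t Ht. exists (d / 2 - Rabs (t - c)). split; [lra|]. intros s Hs.
      replace (s - c) with ((s - t) + (t - c)) by lra.
      eapply Rle_lt_trans; [apply Rabs_triang|lra]. }
    destruct (Hf _ (Ball v)) as [U [HU EU]].
    destruct (trace_dense (fun z => (W z /\ U z) /\ Rabs (G z - G y) < d / 2) y)
      as [p [h [[Wp Up] Gp]]].
    + apply open_inter; [apply open_inter; assumption|exact (HG _ (Ball (G y)))].
    + split; [split; [exact Wy|]|].
      * apply (EU (exist _ y Wy)). fold v. replace (v - v) with 0 by lra. rewrite Rabs_R0. lra.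
      * replace (G y - G y) with 0 by lra. rewrite Rabs_R0. lra.
    + apply (EU (exist _ _ Wp)) in Up. rewrite EG in Gp.
      rewrite Eg, (Hf0 p h Wp) in Gp; [|apply C_cover, h|exists h; exact Wp].
      set (u := f (exist _ _ Wp)) in *.
      assert (T : d <= Rabs (u - v) + Rabs (u - G y)).
      { unfold d. replace (G y - v) with ((u - v) + - (u - G y)) by lra.
        eapply Rle_trans; [apply Rabs_triang|]. rewrite Rabs_Ropp. lra. }
      lra.
Qed.

(** * Small covers and the G_kappa-property *)

Lemma two_clopens (W : S -> Prop) : is_open W -> (exists p, W p) ->
  exists A B, clopen S A /\ clopen S B /\ (exists p, A p) /\ (exists p, B p) /\
    (forall p, A p -> W p /\ p <> x) /\ (forall p, B p -> W p /\ p <> x) /\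
    forall p, ~ (A p /\ B p).
Proof.
  intros HW [p0 Hp0].
  assert (Ex : forall (U : S -> Prop) q, is_open U -> U q -> exists q', q' <> q /\ U q').
  { intros U q HU Uq. apply NNPP. intros N. apply (S_perfect q).
    apply open_eq with (2 := HU). intros q'. split.
    - intros Uq'. apply NNPP. intros D. apply N. eauto.
    - intros ->. exact Uq. }
  assert (E1 : exists p, p <> x /\ W p).
  { destruct (classic (p0 = x)) as [->|D]; [apply Ex|]; eauto. }
  destruct E1 as [p [px Wp]].
  destruct (Ex (fun q => W q /\ q <> x) p) as [q [qp [Wq qx]]]; auto.
  { apply open_inter; [exact HW|exact punctured_open]. }
  destruct (clopen_nbhd (fun r => (W r /\ r <> x) /\ r <> q) p S_zero) as [A [HA [Ap AW]]].
  { apply open_inter; [apply open_inter|]; auto using hausdorff_closed_point, punctured_open. }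
  { auto. }
  destruct (clopen_nbhd (fun r => (W r /\ r <> x) /\ ~ A r) q S_zero) as [B [HB [Bq BW]]].
  { apply open_inter; [apply open_inter; [exact HW|exact punctured_open]|apply HA]. }
  { split; [auto|]. intros Aq. apply (AW q Aq). reflexivity. }
  exists A, B. split; [exact HA|]. split; [exact HB|].
  split; [eauto|]. split; [eauto|]. split; [intros r Ar; apply AW, Ar|].
  split; [intros r Br; apply BW, Br|]. intros r [Ar Br]. apply (BW r Br), Ar.
Qed.

Definition covers {I : Type} (D : I -> Prop) (N : I -> S -> Prop) : Prop :=
  forall p, p <> x -> exists i, D i /\ N i p.

(* At a limit stage without finite subcover, choose disjoint clopen sets [A j], [B j] off all
   earlier members; both unions then accumulate at [x], although their indicator extends over [x]
   by the F_kappa property. *)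
Lemma small_initial_cover (k : K) (N : K -> S -> Prop) :
  (forall i, is_open (N i)) -> (forall i, is_open (fun p => p <> x /\ ~ N i p)) ->
  covers (fun i => lt i k) N ->
  exists l : list K, (forall i, In i l -> lt i k) /\ covers (fun i => In i l) N.
Proof.
  destruct lt_wo as [W [Tr T3]]. revert N.
  induction (W k) as [k _ IH]. intros N NO NC Cov. apply NNPP. intros NF.
  destruct (classic (exists i0, lt i0 k)) as [[i0 Hi0]|E0].
  2: { apply NF. exists nil. split; [intros i []|]. intros p h.
       destruct (Cov p h) as [i [Hi _]]. exfalso. eauto. }
  (* If [m] is the largest index below [k], then [N m] is absorbed into every earlier member, which
     reduces to stage [m]. This requires an earlier index, so a least [m] is treated separately. *)
  destruct (classic (exists m, lt m k /\ forall j, lt j k -> ~ lt m j)) as [[m [Hm Mm]]|Lim].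
  { assert (Lt : forall j, lt j k -> j = m \/ lt j m).
    { intros j Hj. destruct (T3 j m) as [H|[H|H]]; auto. exfalso. exact (Mm j Hj H). }
    destruct (classic (exists i1, lt i1 m)) as [[i1 Hi1]|E1].
    - destruct (IH m Hm (fun i p => N i p \/ N m p)) as [l [Hl Cl]].
      + intros i. apply open_or; apply NO.
      + intros i. apply open_eq with (2 := open_inter S _ _ (NC i) (NC m)). intros p. tauto.
      + intros p h. destruct (Cov p h) as [i [Hi Np]].
        destruct (Lt i Hi) as [->|Li]; eauto.
      + apply NF. exists (m :: l). split.
        * intros i [<-|Hi]; eauto.
        * intros p h. destruct (Cl p h) as [i [Hi [Np|Np]]]; [exists i|exists m]; simpl; auto.
    - apply NF. exists (m :: nil). split; [intros i [<-|[]]; exact Hm|].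
      intros p h. destruct (Cov p h) as [i [Hi Np]]. exists m. split; [simpl; auto|].
      destruct (Lt i Hi) as [->|Li]; [exact Np|exfalso; eauto]. }
  assert (Nx : forall m, lt m k -> exists j, lt j k /\ lt m j).
  { intros m Hm. apply NNPP. intros E. apply Lim. exists m. split; [exact Hm|]. eauto. }
  assert (Bnd : forall l, (forall i, In i l -> lt i k) ->
                 exists j, lt j k /\ forall i, In i l -> lt i j).
  { induction l as [|a l IHl]; intros Hl.
    - exists i0. split; [exact Hi0|intros i []].
    - destruct IHl as [j [Hj Lj]]; [intros i Hi; apply Hl; simpl; auto|].
      destruct (Nx a (Hl a (or_introl eq_refl))) as [a' [Ha' La']].
      destruct (T3 a' j) as [H|[<-|H]].
      + exists j. split; [exact Hj|]. intros i [<-|Hi]; eauto.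
      + exists a'. split; [exact Ha'|]. intros i [<-|Hi]; eauto.
      + exists a'. split; [exact Ha'|]. intros i [<-|Hi]; eauto. }
  assert (Fin : forall A, clopen S A -> (forall p, A p -> p <> x) ->
    exists l, (forall i, In i l -> lt i k) /\ forall p, A p -> exists i, In i l /\ N i p).
  { intros A HA Ax.
    destruct (compact_closed (fun (i : {i | lt i k}) => N (proj1_sig i)) A) as [l Hl]; auto.
    - apply HA.
    - intros p Ap. destruct (Cov p (Ax p Ap)) as [i [Hi Np]]. exists (exist _ i Hi). exact Np.
    - exists (map (@proj1_sig _ _) l). split.
      + intros i Hi. apply in_map_iff in Hi. destruct Hi as [[j Hj] [<- _]]. exact Hj.
      + intros p Ap. destruct (Hl p Ap) as [i [Hi Np]]. exists (proj1_sig i).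
        split; [apply in_map, Hi|exact Np]. }
  set (Rk := fun j (h : K -> (S -> Prop) * (S -> Prop)) (a : (S -> Prop) * (S -> Prop)) =>
    lt j k -> clopen S (fst a) /\ clopen S (snd a) /\ (exists p, fst a p) /\ (exists p, snd a p) /\
    (forall p, fst a p \/ snd a p -> p <> x /\
       forall i, lt i j -> ~ (N i p \/ fst (h i) p \/ snd (h i) p)) /\
    forall p, ~ (fst a p /\ snd a p)).
  destruct (wf_choice lt Rk W) as [g Hg].
  - exact (inhabits (fun _ => True, fun _ => True)).
  - intros j h h' a E H Hj. destruct (H Hj) as (H1 & H2 & H3 & H4 & H5 & H6).
    repeat (split; [assumption|]). split; [|exact H6].
    intros p Hp. split; [apply (H5 p Hp)|]. intros i Hi. rewrite <- (E i Hi). apply (H5 p Hp), Hi.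
  - intros j h IHh.
    destruct (classic (lt j k)) as [Hj|Hj]; [|exists (fun _ => True, fun _ => True); intros H; tauto].
    assert (Hh : forall i, lt i j -> clopen S (fst (h i)) /\ clopen S (snd (h i)) /\
                   forall p, fst (h i) p \/ snd (h i) p -> p <> x).
    { intros i Hi. destruct (IHh i Hi (Tr _ _ _ Hi Hj)) as (H1 & H2 & H3 & H4 & H5 & H6).
      split; [exact H1|split; [exact H2|]]. intros p Hp. apply (H5 p Hp). }
    set (N' := fun i p => N i p \/ (lt i j /\ (fst (h i) p \/ snd (h i) p))).
    assert (NO' : forall i, is_open (N' i)).
    { intros i. apply open_or; [apply NO|].
      destruct (classic (lt i j)) as [Hi|Hi].
      - destruct (Hh i Hi) as [[H1 _] [[H2 _] _]]. apply open_inter; auto using open_const, open_or.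
      - apply open_eq with (fun _ => False); [tauto|apply open_const]. }
    assert (NC' : forall i, is_open (fun p => p <> x /\ ~ N' i p)).
    { intros i. apply open_eq with (fun p => (p <> x /\ ~ N i p) /\
        ~ (lt i j /\ (fst (h i) p \/ snd (h i) p))); [unfold N'; tauto|].
      apply open_inter; [apply NC|]. destruct (classic (lt i j)) as [Hi|Hi].
      - destruct (Hh i Hi) as [H1 [H2 _]].
        apply open_eq with (2 := proj2 (clopen_or _ _ H1 H2)). tauto.
      - apply open_eq with (fun _ => True); [tauto|apply open_full]. }
    (* If the [N' i] with [i] below [j] covered, the induction hypothesis would give a finite
       subcover; its added clopen pairs are compact and miss [x], so finitely many [N i] cover them,
       and the original family would have a finite subcover. *)
    assert (P0 : exists p, p <> x /\ forall i, lt i j -> ~ N' i p).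
    { apply NNPP. intros NP. destruct (IH j Hj N' NO' NC') as [l [Hl Cl]].
      - intros p h0. apply NNPP. intros E. apply NP. exists p. split; [exact h0|]. eauto.
      - destruct (Fin (fun p => exists i, In i l /\ (fst (h i) p \/ snd (h i) p))) as [l' [Hl' Cl']].
        + apply clopen_list_or. intros i Hi. apply Hl in Hi. apply clopen_or; apply (Hh i Hi).
        + intros p [i [Hi Hp]]. exact (proj2 (proj2 (Hh i (Hl i Hi))) p Hp).
        + apply NF. exists (l ++ l'). split.
          * intros i Hi. apply in_app_or in Hi. destruct Hi; eauto.
          * intros p hp. destruct (Cl p hp) as [i [Hi [Np|[_ Np]]]].
            -- exists i. split; [apply in_or_app; auto|exact Np].
            -- destruct (Cl' p) as [i' [Hi' Np']]; [eauto|].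
               exists i'. split; [apply in_or_app; auto|exact Np']. }
    destruct P0 as [p [px Hp]].
    (* The G_kappa-property turns the point [p] into an open set [O] of such points, which has room
       for two disjoint clopen sets. *)
    destruct (S_G (fun U => exists i : {i | lt i j}, (fun q => q <> x /\ ~ N' (proj1_sig i) q) = U))
      as [O [HO [[q Oq] OU]]].
    + intros U [i <-]. apply NC'.
    + eapply le_lt_card; [apply le_card_image|apply lt_small].
    + exists p. intros U [[i Hi] <-]. auto.
    + destruct (two_clopens O HO (ex_intro _ q Oq)) as (A & B & HA & HB & EA & EB & AO & BO & D).
      exists (A, B). intros _. simpl. repeat (split; [assumption|]). split; [|exact D].
      intros r Hr. assert (Or : O r /\ r <> x) by (destruct Hr; auto).
      split; [apply Or|]. intros i Hi Hn.
      apply (OU r (proj1 Or) _ (ex_intro _ (exist _ i Hi) eq_refl)). unfold N'. simpl. tauto.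
  - assert (Disj : forall i j p, lt i k -> lt j k -> fst (g i) p -> snd (g j) p -> False).
    { intros i j p Hi Hj Ap Bp.
      destruct (Hg i Hi) as (_ & _ & _ & _ & Fi & Di).
      destruct (Hg j Hj) as (_ & _ & _ & _ & Fj & Dj).
      destruct (T3 i j) as [L|[<-|L]].
      - apply (proj2 (Fj p (or_intror Bp)) i L). tauto.
      - exact (Di p (conj Ap Bp)).
      - apply (proj2 (Fi p (or_introl Ap)) j L). tauto. }
    set (A := fun p => exists j : {j | lt j k}, fst (g (proj1_sig j)) p).
    set (B := fun p => exists j : {j | lt j k}, snd (g (proj1_sig j)) p).
    assert (AO : is_open A) by (apply open_Union; intros [j Hj]; apply (Hg j Hj)).
    assert (BO : is_open B) by (apply open_Union; intros [j Hj]; apply (Hg j Hj)).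
    assert (DAB : forall p, A p -> ~ B p).
    { intros p [[i Hi] Ap] [[j Hj] Bp]. exact (Disj i j p Hi Hj Ap Bp). }
    destruct (bool_extension K S S_compact S_F (fun p => A p \/ B p) (indicator A))
      as [f [Hf [Ef _]]].
    + apply open_or; assumption.
    + apply type_lt_or; [exact kappaK| |]; (apply type_lt_indexed; [|apply lt_small]);
        intros [j Hj]; apply (Hg j Hj).
    + apply continuous_on_bool.
      * apply open_eq with (2 := AO). intros p. rewrite indicator_true. tauto.
      * apply open_eq with (2 := BO). intros p. rewrite indicator_false.
        split; [|tauto]. intros Bp. split; [tauto|]. intros Ap. exact (DAB p Ap Bp).
    + auto.
    (* The set where [f] differs from [f x] is clopen and misses [x], so finitely many [N i] cover
       it. Past their indices, [fst (g j)] and [snd (g j)] avoid those members, so [f] equals [f x]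
       on both, although it is true on one and false on the other. *)
    + destruct (Fin (fun p => f p <> f x)) as [l [Hl Cl]].
      * split.
        -- apply open_eq with (2 := Hf (fun b => b <> f x) I). tauto.
        -- apply open_eq with (2 := Hf (fun b => ~ b <> f x) I). tauto.
      * intros p Np ->. exact (Np eq_refl).
      * destruct (Bnd l Hl) as [j [Hj Lj]].
        destruct (Hg j Hj) as (_ & _ & [a Ha] & [b Hb] & Fj & _).
        assert (Far : forall p, fst (g j) p \/ snd (g j) p -> f p = f x).
        { intros p Hp. apply NNPP. intros Np. destruct (Cl p Np) as [i [Hi Ni]].
          apply (proj2 (Fj p Hp) i (Lj i Hi)). tauto. }
        assert (Aa : A a) by (exists (exist _ j Hj); exact Ha).
        assert (Bb : B b) by (exists (exist _ j Hj); exact Hb).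
        assert (fa : f a = true) by (rewrite Ef by auto; apply indicator_true, Aa).
        assert (fb : f b = false).
        { rewrite Ef by auto. apply indicator_false. intros Ab. exact (DAB b Ab Bb). }
        rewrite Far in fa, fb by auto. congruence.
Qed.

(** By regularity the image of [I] in [K] lies below some [k]; reindexing along the injection, with
    empty members at the other indices, reduces to the case of an initial segment. *)
Lemma small_cover {I : Type} (N : I -> S -> Prop) : lt_card I K ->
  (forall i, is_open (N i)) -> (forall i, is_open (fun p => p <> x /\ ~ N i p)) ->
  covers (fun _ => True) N -> exists l : list I, covers (fun i => In i l) N.
Proof.
  intros HI NO NC Cov. destruct lt_wo as [W [Tr T3]].
  assert (HI' := HI). destruct HI' as [[c Hc] _].
  destruct (kappa_regular K I (fun i k => lt k (c i) \/ k = c i) kappaK HI) as [k Hk].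
  { intros i. destruct (kappa_unbounded K lt kappaK lt_wo lt_small (c i :: nil)) as [m Hm].
    apply le_lt_card with {j | lt j m}; [|apply lt_small]. apply le_card_sub.
    assert (Hcm := Hm (c i) (or_introl eq_refl)). intros j [Hj | ->]; eauto. }
  destruct (small_initial_cover k (fun j p => exists i, c i = j /\ N i p)) as [l [Hl Cl]].
  - intros j. apply open_Union. intros i. apply open_inter; [apply open_const|apply NO].
  - intros j. destruct (classic (exists i, c i = j)) as [[i <-]|Nj].
    + apply open_eq with (2 := NC i). intros p. split.
      * intros [h Np]. split; [exact h|]. intros [i' [E Np']]. apply Hc in E. subst. auto.
      * intros [h Np]. split; [exact h|]. eauto.
    + apply open_eq with (2 := punctured_open). intros p. split; [|tauto].
      intros h. split; [exact h|]. intros [i [E _]]. eauto.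
  - intros p h. destruct (Cov p h) as [i [_ Np]]. exists (c i). split; [|eauto].
    destruct (T3 (c i) k) as [H|[H|H]]; [exact H| |]; exfalso; apply (Hk i); auto.
  - assert (L : exists l' : list I, forall i, In (c i) l -> In i l').
    { clear Hl Cl. induction l as [|j l [l' Hl']]; [exists nil; intros i []|].
      destruct (classic (exists i, c i = j)) as [[i Ei]|Nj].
      - exists (i :: l'). intros i' [E|Hi]; [left; apply Hc; congruence|right; auto].
      - exists l'. intros i' [E|Hi]; [exfalso; eauto|auto]. }
    destruct L as [l' Hl']. exists l'. intros p h.
    destruct (Cl p h) as [j [Hj [i [<- Np]]]]. eauto.
Qed.

(** After shrinking to clopen sets around [y], either their traces have a common point and the
    G_kappa-property of [S] applies, or their complements cover the punctured space. In the latter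
    case a finite subcover contradicts density at [y]. *)
Lemma stone_cech_G_kappa : G_kappa_space K Y.
Proof.
  intros F HF CF [y Hy].
  destruct (choice_fun (fun (U : {U | F U}) V => clopen Y V /\ V y /\
    forall z, V z -> proj1_sig U z)) as [V HV].
  { intros [U HU]. simpl.
    apply clopen_nbhd; [exact stone_cech_zero_dimensional|exact (HF U HU)|exact (Hy U HU)]. }
  destruct (classic (exists p, p <> x /\ forall i, trace (V i) p)) as [[p [px Hp]]|N].
  - destruct (S_G (fun U => exists i, trace (V i) = U)) as [W [HW [EW HWV]]].
    + intros U [i <-]. apply trace_open, HV.
    + eapply le_lt_card; [apply le_card_image|exact CF].
    + exists p. intros U [i <-]. apply Hp.
    + destruct (two_clopens W HW EW) as (A & _ & HA & _ & [a Aa] & _ & AW & _).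
      destruct (open_trace A (proj1 HA)) as [O [HO EO]].
      { intros q Aq. apply (AW q Aq). }
      exists O. split; [exact HO|split].
      * apply EO in Aa. destruct Aa as [h Oa]. eauto.
      * intros z Oz U HU. apply (HV (exist _ U HU)).
        apply (trace_closed_sub O (V (exist _ U HU))); [exact HO|apply HV| |exact Oz].
        intros q Oq. apply EO in Oq. apply (HWV q); [apply (AW q Oq)|eauto].
  - exfalso. destruct (small_cover (fun i => trace (fun z => ~ V i z)) CF) as [l Hl].
    + intros i. apply trace_open, HV.
    + intros i. apply open_eq with (2 := trace_open _ (proj1 (proj1 (HV i)))).
      intros p. rewrite trace_not. split.
      * intros Hp. split; [destruct Hp; assumption|tauto].
      * intros [h Hp]. apply NNPP. tauto.
    + intros p h. apply NNPP. intros E. apply N. exists p. split; [exact h|].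
      intros i. apply NNPP. intros Vp. apply E. exists i. split; [exact I|].
      apply trace_not. auto.
    + destruct (trace_dense (fun z => forall i, In i l -> V i z) y) as [p [h Hp]].
      * apply open_list_inter. intros i. apply HV.
      * intros i _. apply HV.
      * destruct (Hl p h) as [i [Hi [h' Np]]]. apply Np.
        rewrite (proof_irrelevance _ h' h). auto.
Qed.

(** * The weight *)

Lemma escaping_clopens : exists A : K -> S -> Prop, (forall k, clopen S (A k)) /\
  (forall k, exists p, A k p) /\ (forall k p, A k p -> p <> x) /\
  forall j k p, lt j k -> A k p -> ~ A j p /\ ~ C j p.
Proof.
  set (Rk := fun k (h : K -> S -> Prop) (a : S -> Prop) => clopen S a /\ (exists p, a p) /\
    (forall p, a p -> p <> x) /\ forall j p, lt j k -> a p -> ~ h j p /\ ~ C j p).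
  destruct (wf_choice lt Rk (proj1 lt_wo)) as [A HA].
  - exact (inhabits (fun _ => True)).
  - intros k h h' a E (H1 & H2 & H3 & H4). repeat (split; [assumption|]).
    intros j p Hj. rewrite <- (E j Hj). auto.
  - intros k h IH.
    destruct (S_G (fun U => exists j : {j | lt j k},
      (fun p => ~ h (proj1_sig j) p /\ ~ C (proj1_sig j) p) = U)) as [W [HW [EW WU]]].
    + intros U [[j Hj] <-]. apply open_inter; [apply (IH j Hj)|apply C_clopen].
    + eapply le_lt_card; [apply le_card_image|apply lt_small].
    (* All sets to be avoided are clopen and miss [x], so [x] itself shows that the intersection of
       their complements is non-empty. *)
    + exists x. intros U [[j Hj] <-]. simpl. split.
      * intros Hx. exact (proj1 (proj2 (proj2 (IH j Hj))) x Hx eq_refl).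
      * intros Cx. apply (proj1 (C_cover x)); eauto.
    + destruct (two_clopens W HW EW) as (a & _ & Ha & _ & Ea & _ & aW & _).
      exists a. split; [exact Ha|]. split; [exact Ea|]. split; [intros p Hp; apply (aW p Hp)|].
      intros j p Hj Hp. exact (WU p (proj1 (aW p Hp)) _ (ex_intro _ (exist _ j Hj) eq_refl)).
  - exists A. split; [|split; [|split]]; intros; eapply HA; eassumption.
Qed.

(** A set [A j] with [j] above [k] misses [C k], so the trace of the union on [C k] involves only
    indices up to [k] and has type below [K]. *)
Lemma clopen_selection (A : K -> S -> Prop) : (forall k, clopen S (A k)) ->
  (forall j k p, lt j k -> A k p -> ~ A j p /\ ~ C j p) -> forall E : K -> Prop,
  exists V, clopen Y V /\ forall k p, p <> x -> A k p -> (trace V p <-> E k).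
Proof.
  intros HA Esc E. destruct lt_wo as [W [Tr T3]].
  assert (Uniq : forall j k p, A j p -> A k p -> j = k).
  { intros j k p Aj Ak. destruct (T3 j k) as [L|[L|L]]; [|exact L|]; exfalso.
    - exact (proj1 (Esc j k p L Ak) Aj).
    - exact (proj1 (Esc k j p L Aj) Ak). }
  destruct (clopen_extension (fun p => exists k, A k p)
    (indicator (fun p => exists k, E k /\ A k p))) as [V [HV EV]].
  - apply open_Union. intros k. apply HA.
  - intros k. destruct (kappa_unbounded K lt kappaK lt_wo lt_small (k :: nil)) as [m Hm].
    assert (km := Hm k (or_introl eq_refl)).
    replace (fun p => (exists i, A i p) /\ C k p)
      with (fun p => exists j : {j | lt j m}, A (proj1_sig j) p /\ C k p).
    + apply type_lt_indexed; [|apply lt_small]. intros j. apply clopen_and; auto.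
    + apply pred_ext. intros p. split.
      * intros [j [Aj Ck]]. eauto.
      * intros [[j Aj] Ck]. assert (jm : lt j m).
        { destruct (T3 j k) as [L|[->|L]]; [eauto|exact km|].
          exfalso. exact (proj2 (Esc k j p L Aj) Ck). }
        exists (exist _ j jm). auto.
  - apply continuous_on_bool.
    + apply open_eq with (fun p => exists k, E k /\ A k p).
      * intros p. rewrite indicator_true. split; [|tauto]. intros [k [Ek Ak]]. eauto.
      * apply open_Union. intros k. apply open_inter; [apply open_const|apply HA].
    + apply open_eq with (fun p => exists k, ~ E k /\ A k p).
      * intros p. rewrite indicator_false. split.
        -- intros [k [Nk Ak]]. split; [eauto|]. intros [j [Ej Aj]].
           apply Nk. rewrite <- (Uniq j k p Aj Ak). exact Ej.
        -- intros [[k Ak] N]. exists k. split; [|exact Ak]. eauto.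
      * apply open_Union. intros k. apply open_inter; [apply open_const|apply HA].
  - exists V. split; [exact HV|]. intros k p h Ak. rewrite EV; [|exact h|eauto].
    rewrite indicator_true. split; [|eauto]. intros [j [Ej Aj]].
    rewrite <- (Uniq j k p Aj Ak). exact Ej.
Qed.

(** The point [y s] lies in [V s] and in no other [V t], so a base member that contains [y s] and is
    contained in [V s] determines [s]. *)
Lemma weight_lower (B : (Y -> Prop) -> Prop) : is_base Y B ->
  le_card (K -> bool) {U : Y -> Prop | B U}.
Proof.
  intros [_ HB].
  destruct escaping_clopens as (A & HA & EA & Ax & Esc).
  destruct (finitely_independent_sets K lt kappaK lt_wo lt_small) as [E HE].
  destruct (choice_fun (fun s V => clopen Y V /\
    forall k p, p <> x -> A k p -> (trace V p <-> E s k))) as [V HV].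
  { intros s. apply clopen_selection; assumption. }
  destruct (choice_fun (fun s y => V s y /\ forall t, t <> s -> ~ V t y)) as [y Hy].
  (* If the other [V t] covered [V s], finitely many of them would; but finite independence provides
     an index [k] for which [A k] lies in the trace of [V s] and misses the traces of those
     [V t]. *)
  { intros s. apply NNPP. intros N.
    destruct (compact_closed (fun t : {t | t <> s} => V (proj1_sig t)) (V s)) as [l Hl]; auto.
    - apply HV.
    - intros [t Ht]. apply HV.
    - intros z Vz. apply NNPP. intros N'. apply N. exists z. split; [exact Vz|].
      intros t Ht Vt. apply N'. exists (exist _ t Ht). exact Vt.
    - destruct (HE s (map (@proj1_sig _ _) l)) as [k [Ek Nk]].
      { intros t Ht. apply in_map_iff in Ht. destruct Ht as [[t' Ht'] [<- _]]. exact Ht'. }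
      destruct (EA k) as [p Ap]. assert (h := Ax k p Ap).
      destruct (Hl (e (exist _ p h))) as [t [Ht Vt]].
      + apply trace_at. apply (HV s) with k; assumption.
      + apply trace_at in Vt. apply (HV (proj1_sig t)) with (k := k) in Vt; [|assumption..].
        exact (Nk _ (in_map _ _ _ Ht) Vt). }
  destruct (choice_fun (fun s (U : {U | B U}) => proj1_sig U (y s) /\
    forall z, proj1_sig U z -> V s z)) as [U HU].
  { intros s. destruct (HB (V s) (proj1 (proj1 (HV s))) (y s) (proj1 (Hy s))) as [U [BU HU]].
    exists (exist _ U BU). exact HU. }
  exists U. intros s t Est. apply NNPP. intros Nst.
  apply (proj2 (Hy s) t); [congruence|]. apply (HU t). rewrite <- Est. apply (HU s).
Qed.

(** By density a clopen set of [Y] is determined by its trace, and the trace, being open, by the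
    members of a base of [S] that it contains. *)
Lemma weight_upper : weight_is S K -> le_card {U : Y -> Prop | clopen Y U} (K -> bool).
Proof.
  intros [[B [[_ HB] [c Hc]]] _].
  exists (fun V k => indicator (fun k => exists U : {U | B U}, c U = k /\
    forall p, proj1_sig U p -> trace (proj1_sig V) p) k).
  assert (Sub : forall V V' : {U | clopen Y U},
    (forall k, indicator (fun k => exists U : {U | B U}, c U = k /\
       forall p, proj1_sig U p -> trace (proj1_sig V) p) k =
     indicator (fun k => exists U : {U | B U}, c U = k /\
       forall p, proj1_sig U p -> trace (proj1_sig V') p) k) ->
    forall y, proj1_sig V y -> proj1_sig V' y).
  { intros [V HV] [V' HV'] E. apply trace_closed_sub; [apply HV|apply HV'|]. simpl in *.
    intros p Vp. destruct (HB _ (trace_open V (proj1 HV)) p Vp) as [U [BU [Up UV]]].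
    assert (T : indicator (fun k => exists U : {U | B U}, c U = k /\
       forall p, proj1_sig U p -> trace V p) (c (exist _ U BU)) = true).
    { apply indicator_true. exists (exist _ U BU). auto. }
    rewrite E in T. apply (proj1 (indicator_true _ _)) in T. destruct T as [U' [E' UV']].
    apply Hc in E'. subst U'. apply UV'. exact Up. }
  intros V V' E. assert (E1 := equal_f E).
  assert (EQ : proj1_sig V = proj1_sig V').
  { apply pred_ext. intros y. split; apply Sub; [|symmetry]; auto. }
  destruct V, V'. apply sig_eq, EQ.
Qed.

End Remainder.

(** The base members that lie in a clopen set missing [x] already cover the complement of [x]. Each
    is enlarged to such a clopen set, placed at its code in [K]; for the other indices the empty set
    qualifies. *)
Lemma punctured_cover (K : Type) (S : TopSpace) (x : S) : hausdorff S -> zero_dimensional S ->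
  weight_is S K ->
  exists C : K -> S -> Prop, (forall k, clopen S (C k)) /\
    forall p, (exists k, C k p) <-> p <> x.
Proof.
  intros HH HZ [[B [[_ HB] [c Hc]]] _].
  destruct (choice_fun (fun k C => clopen S C /\ ~ C x /\ forall U : {U | B U}, c U = k ->
    (exists D, clopen S D /\ ~ D x /\ forall p, proj1_sig U p -> D p) ->
    forall p, proj1_sig U p -> C p)) as [C HC].
  { intros k. destruct (classic (exists U : {U | B U}, c U = k /\
      exists D, clopen S D /\ ~ D x /\ forall p, proj1_sig U p -> D p))
      as [[U [Uk [D [HD [Dx UD]]]]]|N].
    - exists D. split; [exact HD|split; [exact Dx|]]. intros U' Uk' _ p Up.
      rewrite (Hc U' U) in Up by congruence. auto.
    - exists (fun _ => False). split; [apply clopen_const|split; [auto|]].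
      intros U Uk HD. exfalso. eauto. }
  exists C. split; [intros k; apply HC|]. intros p. split.
  - intros [k Ck] ->. apply (HC k), Ck.
  - intros px. destruct (clopen_nbhd (fun q => q <> x) p HZ) as [D [HD [Dp Dx]]]; auto.
    { apply hausdorff_closed_point, HH. }
    destruct (HB D (proj1 HD) p Dp) as [U [BU [Up UD]]].
    exists (c (exist _ U BU)). apply (HC (c (exist _ U BU))) with (exist _ U BU); auto.
    exists D. split; [exact HD|split; [|exact UD]]. intros Dx'. exact (Dx x Dx' eq_refl).
Qed.

Theorem theorem5p2 (K : Type) (S : TopSpace) :
  kappa_eq_kappa_lt K ->
  kappa_Parovicenko K S -> weight_is S K ->
  forall (x : S) (Y : TopSpace) (e : subspace S (fun y => y <> x) -> Y),
    is_stone_cech (subspace S (fun y => y <> x)) Y e ->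
    kappa_Parovicenko K Y /\ weight_is Y (K -> bool).
Proof.
  intros HK HS HW x Y e He.
  destruct (initial_well_order K) as [lt [WO Sm]].
  destruct (punctured_cover K S x (proj1 (proj2 HS)) (proj1 (proj2 (proj2 HS))) HW)
    as [C [HC CC]].
  assert (HZ : zero_dimensional Y) by (eapply stone_cech_zero_dimensional; eauto).
  split.
  - split; [apply He|]. split; [apply He|]. split; [exact HZ|].
    split; [eapply stone_cech_F_kappa; eauto|].
    split; [eapply stone_cech_G_kappa; eauto|eapply stone_cech_no_isolated; eauto].
  - split.
    + exists (clopen Y). split; [exact HZ|]. eapply weight_upper; eauto.
    + intros B. eapply weight_lower; eauto.
Qed.
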